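(* Let $n\ge 1$ and let $H=H(x,y,p):\mathbb{R}^n\times\mathbb{T}^n\times\mathbb{R}^n\to\mathbb{R}$ satisfy: (H1) for each $R>0$, $H$ is bounded and uniformly continuous on $\mathbb{R}^n\times\mathbb{T}^n\times \mathrm{B}(0,R)$; (H2) $\lim_{|p|\to\infty}\left(\inf_{x\in\mathbb{R}^n,\,y\in\mathbb{T}^n}H(x,y,p)\right)=+\infty$; (H3) for each $x\in\mathbb{R}^n$ and $y\in\mathbb{T}^n$, the map $p\mapsto H(x,y,p)$ is convex; (H4) there exists a constant $\mathrm{Lip}(H)>0$ such that $|H(x_1,y,p)-H(x_2,y,p)|\le \mathrm{Lip}(H)|x_1-x_2|$ for all $x_1,x_2\in\mathbb{R}^n$, $y\in\mathbb{T}^n$, $p\in\mathbb{R}^n$. For $\lambda,\epsilon>0$, let $u^\epsilon$ be the unique viscosity solution to $$\lambda u^\epsilon+H\left(x,\frac{x}{\epsilon},Du^\epsilon\right)=0\quad\text{in }\mathbb{R}^n,$$ and let $u$ be the unique viscosity solution to $$\lambda u+\overline{H}(x,Du)=0\quad\text{in }\mathbb{R}^n,$$ where $\overline{H}$ is the effective Hamiltonian of $H$. Then there exists a constant $C>0$ depending only on $n$ and $H$ such that for all $\lambda,\epsilon\in(0,1)$, $$\|u^\epsilon-u\|_{L^\infty(\mathbb{R}^n)}\le\frac{C\sqrt{\epsilon}}{\lambda}.$$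
   Context: $\mathbb{T}^n=\mathbb{R}^n/\mathbb{Z}^n$ is the flat torus; functions on $\mathbb{T}^n$ are identified with $\mathbb{Z}^n$-periodic functions on $\mathbb{R}^n$, so $H(x,x/\epsilon,p)$ makes sense. $\mathrm{B}(0,R)$ is the ball of radius $R$ centred at $0$ in $\mathbb{R}^n$. Effective Hamiltonian: for each $(x,p)\in\mathbb{R}^n\times\mathbb{R}^n$, $\overline{H}(x,p)$ is the unique real constant for which the cell problem $H(x,y,p+Dv(y))=\overline{H}(x,p)$ for $y\in\mathbb{T}^n$ has a continuous (periodic) viscosity solution $v:\mathbb{T}^n\to\mathbb{R}$. Solutions of the static problems are viscosity solutions, unique in the class of bounded uniformly continuous functions on $\mathbb{R}^n$. *)

(* Defs.v *)
From HB Require Import structures.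
From mathcomp Require Import all_boot all_order all_algebra.
From mathcomp Require Import all_classical all_reals all_analysis.
Import Order.TTheory GRing.Theory Num.Theory.
Import numFieldNormedType.Exports.

Set Implicit Arguments.
Unset Strict Implicit.
Unset Printing Implicit Defensive.

Local Open Scope classical_set_scope.
Local Open Scope ring_scope.

(* Euclidean norm: the library norm on 'rV[R]_n is the max norm. *)
Definition enorm (R : realType) (n : nat) (x : 'rV[R]_n) : R :=
  Num.sqrt (\sum_(i < n) x 0 i ^+ 2).

(* Functions on the torus R^n / Z^n are Z^n-periodic functions on R^n. *)
Definition Zperiodic (R : realType) (n : nat) (T : Type) (f : 'rV[R]_n -> T) :=
  forall (y : 'rV[R]_n) (k : 'rV[int]_n), f (y + map_mx intr k) = f y.

Definition BUC (R : realType) (n : nat) (u : 'rV[R]_n -> R) :=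
  (exists M : R, forall x, `|u x| <= M) /\ unif_continuous u.

Definition grad (R : realType) (n : nat) (phi : 'rV[R]_n -> R) (x : 'rV[R]_n)
  : 'rV[R]_n := \row_(j < n) 'd phi x (delta_mx 0 j).

Definition C1 (R : realType) (n : nat) (phi : 'rV[R]_n -> R) :=
  (forall x, differentiable phi x) /\ continuous (grad phi).

(* Viscosity sub/supersolutions of F (x, u, Du) = 0 in R^n. *)
Definition viscosity_subsolution (R : realType) (n : nat)
    (F : 'rV[R]_n -> R -> 'rV[R]_n -> R) (u : 'rV[R]_n -> R) :=
  forall (phi : 'rV[R]_n -> R) (x0 : 'rV[R]_n), C1 phi ->
    (\forall x \near x0, u x - phi x <= u x0 - phi x0) ->
    F x0 (u x0) (grad phi x0) <= 0.

Definition viscosity_supersolution (R : realType) (n : nat)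
    (F : 'rV[R]_n -> R -> 'rV[R]_n -> R) (u : 'rV[R]_n -> R) :=
  forall (phi : 'rV[R]_n -> R) (x0 : 'rV[R]_n), C1 phi ->
    (\forall x \near x0, u x0 - phi x0 <= u x - phi x) ->
    0 <= F x0 (u x0) (grad phi x0).

Definition viscosity_solution (R : realType) (n : nat)
    (F : 'rV[R]_n -> R -> 'rV[R]_n -> R) (u : 'rV[R]_n -> R) :=
  [/\ continuous u, viscosity_subsolution F u & viscosity_supersolution F u].

(* A viscosity solution on the torus is a periodic viscosity solution on R^n. *)
Definition cell_problem_solvable (R : realType) (n : nat)
    (H : 'rV[R]_n -> 'rV[R]_n -> 'rV[R]_n -> R) (x p : 'rV[R]_n) (c : R) :=
  exists v : 'rV[R]_n -> R,
    Zperiodic v /\ viscosity_solution (fun y _ q => H x y (p + q) - c) v.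

Definition effective_hamiltonian (R : realType) (n : nat)
    (H : 'rV[R]_n -> 'rV[R]_n -> 'rV[R]_n -> R)
    (Hbar : 'rV[R]_n -> 'rV[R]_n -> R) :=
  forall x p, unique (cell_problem_solvable H x p) (Hbar x p).

(* By periodicity in y, uniform continuity for the distance of the torus is
   the same as uniform continuity on R^n in the y variable. *)
Definition hypH1 (R : realType) (n : nat)
    (H : 'rV[R]_n -> 'rV[R]_n -> 'rV[R]_n -> R) :=
  forall r : R, 0 < r ->
    (exists M : R, forall x y p, enorm p < r -> `|H x y p| <= M) /\
    (forall e : R, 0 < e -> exists2 d : R, 0 < d &
       forall x1 x2 y1 y2 p1 p2, enorm p1 < r -> enorm p2 < r ->
         enorm (x1 - x2) < d -> enorm (y1 - y2) < d -> enorm (p1 - p2) < d ->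
         `|H x1 y1 p1 - H x2 y2 p2| < e).

Definition hypH2 (R : realType) (n : nat)
    (H : 'rV[R]_n -> 'rV[R]_n -> 'rV[R]_n -> R) :=
  forall M : R, exists r : R, forall p, r < enorm p ->
    (M%:E <= ereal_inf [set (H z.1 z.2 p)%:E | z in [set: 'rV[R]_n * 'rV[R]_n]])%E.

Definition hypH3 (R : realType) (n : nat)
    (H : 'rV[R]_n -> 'rV[R]_n -> 'rV[R]_n -> R) :=
  forall x y, convex_function (E := 'rV[R]_n) [set: 'rV[R]_n] (H x y).

Definition hypH4 (R : realType) (n : nat)
    (H : 'rV[R]_n -> 'rV[R]_n -> 'rV[R]_n -> R) :=
  exists2 L : R, 0 < L & forall x1 x2 y p,
    `|H x1 y p - H x2 y p| <= L * enorm (x1 - x2).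

(* For continuous functions this is the L^oo norm with respect to the Lebesgue
   measure of R^n. *)
Definition supnorm (R : realType) (n : nat) (f : 'rV[R]_n -> R) : \bar R :=
  ereal_sup [set `|f x|%:E | x in [set: 'rV[R]_n]].

(* Main.v *)
(* Only paraboloids are used as test functions. A bounded subsolution is replaced by
   its sup-convolution, which has at every point a subgradient satisfying the
   inequality up to a small error; since H is convex in p, averages of such functions
   are again subsolutions in this sense, and one compares with a supersolution by
   minimising the difference.

   [ueps <= u + C sqrt eps / lam]: averaging ueps over the N^n translates by eps Z^n,
   N ~ 1/sqrt eps, moves it by O(N eps) and makes its lattice increments nearly
   independent of the base point. Near the point of contact with a paraboloid of
   curvature 1/sqrt eps the rescaled average is then, up to O(sqrt eps), an affine
   function of slope p plus a periodic one, so the corrector at p can be compared with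
   it, which bounds Hbar at p.

   [u <= ueps + C sqrt eps / lam]: choose points z on a fine grid, subgradients p_z of u
   and correctors phi_z at (z, p_z). The function
   T(x) = sum_z W_z(x) (u(z) + eps phi_z(x / eps)), with a partition of unity W of
   width sqrt eps, has gradient sum_z W_z (p_z + D phi_z(x / eps)) up to
   eps * sum_z |D W_z| = O(sqrt eps); by convexity it is an approximate subsolution of
   the oscillating equation. No regularity of p |-> phi is needed. *)
Require Import Defs.
From mathcomp Require Import all_boot all_order all_algebra.
From mathcomp Require Import all_classical all_reals all_analysis.
From mathcomp Require Import ring lra.
Import Order.TTheory GRing.Theory Num.Theory.
Import numFieldNormedType.Exports.
Local Open Scope classical_set_scope.
Local Open Scope ring_scope.

Set Implicit Arguments.
Unset Strict Implicit.
Unset Printing Implicit Defensive.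

(** * Euclidean norm and minimisation *)

Section Euclid.
Context {R : realType} {n : nat}.
Implicit Types (x y z p q : 'rV[R]_n) (a b c : R).

(** The rate comes from using the single length [S] = sqrt eps wherever a scale is quantitative. In
    one direction, averaging over N periods displaces points by N eps and leaves an error 1/N in the
    increments; N ~ 1/S balances the two. In the other, freezing the slow data on cells of width S
    costs O(S) by the Lipschitz bound in x, while the derivative of the weights against eps phi
    costs eps / S = S. Uniformity in lam has two sources: the difference is estimated after
    multiplication by lam, and the bound - M0 <= lam u forces the gradient of any paraboloid
    touching a solution from above into a sublevel [M0] of the Hamiltonian, hence into a ball of
    radius [R0] fixed by coercivity. The semiconvexity constants that come from the modulus of
    continuity of [H] are uncontrolled and must stay out of [C]; this is why Lipschitz bounds are
    drawn from subgradients alone and why the mesh of the grid is chosen last. Only the function in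
    the role of subsolution is ever regularised: where the difference is minimal, its lower
    expansion becomes a paraboloid touching the supersolution from below. *)

Definition dot x y : R := \sum_(i < n) x 0 i * y 0 i.

Lemma dotC x y : dot x y = dot y x.
Proof. by apply: eq_bigr => i _; rewrite mulrC. Qed.

Lemma dotDl x y z : dot (x + y) z = dot x z + dot y z.
Proof. by rewrite -big_split; apply: eq_bigr => i _; rewrite mxE mulrDl. Qed.

Lemma dotZl a x y : dot (a *: x) y = a * dot x y.
Proof. by rewrite mulr_sumr; apply: eq_bigr => i _; rewrite mxE mulrA. Qed.

Lemma dotDr x y z : dot x (y + z) = dot x y + dot x z.
Proof. by rewrite !(dotC x) dotDl. Qed.

Lemma dotZr a x y : dot x (a *: y) = a * dot x y.
Proof. by rewrite !(dotC x) dotZl. Qed.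

Lemma dotNl x y : dot (- x) y = - dot x y.
Proof. by rewrite -scaleN1r dotZl mulN1r. Qed.

Lemma dotNr x y : dot x (- y) = - dot x y.
Proof. by rewrite !(dotC x) dotNl. Qed.

Lemma dot0r x : dot x 0 = 0.
Proof. by rewrite -(scale0r x) dotZr mul0r. Qed.

Definition dotE := (dotDl, dotDr, dotNl, dotNr, dotZl, dotZr).

Lemma dot_sumr (I : finType) x (f : I -> 'rV[R]_n) :
  dot x (\sum_i f i) = \sum_i dot x (f i).
Proof.
apply: (big_ind2 (fun u v => dot x u = v)) => //; first exact: dot0r.
by move=> ? ? ? ? <- <-; rewrite dotDr.
Qed.

Lemma dotxx x : dot x x = enorm x ^+ 2.
Proof.
rewrite /enorm sqr_sqrtr; first by apply: eq_bigr => i _; rewrite expr2.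
by apply: sumr_ge0 => i _; exact: sqr_ge0.
Qed.

Lemma enorm_ge0 x : 0 <= enorm x. Proof. exact: sqrtr_ge0. Qed.

Lemma enorm0 : enorm (0 : 'rV[R]_n) = 0.
Proof. by apply/eqP; rewrite -sqrf_eq0 -dotxx dot0r. Qed.

Lemma enormZ a x : enorm (a *: x) = `|a| * enorm x.
Proof.
apply/eqP; rewrite -(@eqrXn2 _ 2) ?mulr_ge0 ?enorm_ge0//.
by rewrite exprMn real_normK ?num_real// -!dotxx !dotE mulrA expr2.
Qed.

Lemma enormN x : enorm (- x) = enorm x.
Proof. by rewrite -scaleN1r enormZ normrN1 mul1r. Qed.

Lemma enormB x y : enorm (x - y) = enorm (y - x).
Proof. by rewrite -enormN opprB. Qed.

Lemma enorm_coord x i : `|x 0 i| <= enorm x.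
Proof.
rewrite -(@ler_pXn2r _ 2) ?nnegrE ?enorm_ge0// real_normK ?num_real// -dotxx.
rewrite /dot (bigD1 i)//= expr2 lerDl; apply: sumr_ge0 => j _.
by rewrite -expr2 sqr_ge0.
Qed.

Lemma enorm_eq0 x : enorm x = 0 -> x = 0.
Proof.
move=> x0; apply/rowP => i; rewrite mxE; apply/eqP.
by rewrite -normr_eq0 eq_le normr_ge0 andbT -x0 enorm_coord.
Qed.

Lemma dot_le x y : dot x y <= enorm x * enorm y.
Proof.
have [/eqP x0|x0] := boolP (enorm x == 0).
  by rewrite (enorm_eq0 x0) dotC dot0r enorm0 mul0r.
have [/eqP y0|y0] := boolP (enorm y == 0).
  by rewrite (enorm_eq0 y0) dot0r enorm0 mulr0.
have xy : 0 < enorm x * enorm y by rewrite mulr_gt0// lt0r enorm_ge0 ?x0 ?y0.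
have : 0 <= enorm (enorm y *: x - enorm x *: y) ^+ 2 by rewrite sqr_ge0.
rewrite -dotxx !dotE !dotxx (dotC y x) => h.
rewrite -(ler_pM2l xy).
move: (enorm x) (enorm y) (dot x y) h {x0 y0 xy} => a b d; lra.
Qed.

Lemma dot_norm x y : `|dot x y| <= enorm x * enorm y.
Proof.
rewrite ler_norml dot_le andbT lerNl -dotNl -(enormN x); exact: dot_le.
Qed.

Lemma enormD x y : enorm (x + y) <= enorm x + enorm y.
Proof.
rewrite -(@ler_pXn2r _ 2) ?nnegrE ?addr_ge0 ?enorm_ge0//.
rewrite -dotxx !dotE !dotxx (dotC y x).
by have := dot_le x y; move: (enorm x) (enorm y) (dot x y) => a b d; lra.
Qed.

Lemma enorm_sum (I : finType) (f : I -> 'rV[R]_n) :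
  enorm (\sum_i f i) <= \sum_i enorm (f i).
Proof.
apply: (big_ind2 (fun u v => enorm u <= v)); rewrite ?enorm0//.
by move=> u a v b ua vb; apply: (le_trans (enormD _ _)); exact: lerD.
Qed.

Lemma enorm_le_sum x : enorm x <= \sum_(i < n) `|x 0 i|.
Proof.
rewrite -(@ler_pXn2r _ 2) ?nnegrE ?enorm_ge0 ?sumr_ge0//.
rewrite -dotxx expr2 mulr_suml; apply: ler_sum => i _.
apply: (le_trans (ler_norm _)); rewrite normrM ler_wpM2l//.
by rewrite (bigD1 i)//= lerDl sumr_ge0.
Qed.

Lemma enorm_le_coord x a : (forall i, `|x 0 i| <= a) -> enorm x <= n%:R * a.
Proof.
move=> xa; apply: (le_trans (enorm_le_sum x)).
rewrite -[X in X%:R * a](card_ord n) -sum1_card natr_sum mulr_suml.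
by apply: ler_sum => i _; rewrite mul1r.
Qed.

Lemma enorm_sqD x y : enorm (x + y) ^+ 2 = enorm x ^+ 2 + 2 * dot x y + enorm y ^+ 2.
Proof. by rewrite -!dotxx !dotE (dotC y x); ring. Qed.

Lemma norm_coord x i : `|x 0 i| <= `|x|.
Proof.
rewrite [leRHS]/Num.norm /= mx_normrE; apply/bigmax_geP; right => /=.
by exists (ord0, i).
Qed.

Lemma enorm_le_norm x : enorm x <= n%:R * `|x|.
Proof. exact/enorm_le_coord/norm_coord. Qed.

Lemma norm_le_enorm x : `|x| <= enorm x.
Proof.
rewrite [leLHS]/Num.norm /= mx_normrE; apply/bigmax_leP; split.
  exact: enorm_ge0.
by move=> [i j] _ /=; rewrite (ord1 i); exact: enorm_coord.
Qed.

Lemma enorm_nbhs x e : 0 < e -> \forall y \near x, enorm (y - x) < e.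
Proof.
move=> e0; apply/nbhs_ballP; exists (e / (n%:R + 1)) => /=.
  by rewrite divr_gt0// ltr_wpDl.
move=> y; rewrite -ball_normE /= => xy; rewrite enormB.
apply: (le_lt_trans (enorm_le_norm _)).
have : n%:R * `|x - y| <= (n%:R + 1) * `|x - y| by rewrite ler_wpM2r// lerDl.
by move=> /le_lt_trans; apply; rewrite mulrC -ltr_pdivlMr// ltr_wpDl.
Qed.

Lemma enorm_continuous : continuous (fun x => enorm x).
Proof.
move=> x; apply/(@cvgrPdist_lt _ _ _ _ (nbhs_filter (x : 'rV[R]_n))) => e e0.
apply: (@filterS _ _ (nbhs_filter x) _ _ _ (enorm_nbhs x e0)) => y.
apply: le_lt_trans; rewrite ler_norml.
have := enormD (y - x) x; have := enormD (x - y) y; rewrite !subrK (enormB x y).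
lra.
Qed.

Lemma continuous_enorm (u : 'rV[R]_n -> R) :
  (forall x e, 0 < e -> exists2 d, 0 < d &
    forall y, enorm (y - x) < d -> `|u y - u x| < e) -> continuous u.
Proof.
move=> h x; apply/(@cvgrPdist_lt _ _ _ _ (nbhs_filter (x : 'rV[R]_n))).
move=> e /(h x)[d d0 hd].
apply: (@filterS _ _ (nbhs_filter x) _ _ _ (enorm_nbhs x d0)) => y xy; by rewrite distrC; exact: hd.
Qed.

Lemma lipschitz_continuous (u : 'rV[R]_n -> R) L :
  (forall x y, `|u y - u x| <= L * enorm (y - x)) -> continuous u.
Proof.
move=> h; apply: continuous_enorm => x e e0.
have L0 : 0 < `|L| + 1 by rewrite ltr_wpDl.
exists (e / (`|L| + 1)) => [|y]; first by rewrite divr_gt0.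
rewrite ltr_pdivlMr// => xy; apply: (le_lt_trans (h _ _)).
apply: le_lt_trans xy; rewrite mulrC ler_wpM2l ?enorm_ge0//.
by apply: (le_trans (ler_norm _)); rewrite lerDl.
Qed.

Lemma continuous_enormP (u : 'rV[R]_n -> R) : continuous u ->
  forall x e, 0 < e -> exists2 d, 0 < d &
    forall y, enorm (y - x) < d -> `|u y - u x| < e.
Proof.
move=> cu x e e0.
have /(@cvgrPdist_lt _ _ _ _ (nbhs_filter (x : 'rV[R]_n))) := cu x.
move=> /(_ e e0) /nbhs_ballP [d /= d0 hd]; exists d => // y xy.
rewrite distrC; apply: hd; rewrite -ball_normE /=.
by rewrite -normrN opprB (le_lt_trans (norm_le_enorm _)).
Qed.

Lemma continuous_affine (f : 'rV[R]_n -> R) (c : R) y : continuous f ->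
  continuous (fun x => f (c *: x + y)).
Proof.
move=> cf; apply: continuous_enorm => x e /(continuous_enormP cf (c *: x + y)).
have c0 : 0 < `|c| + 1 by rewrite ltr_wpDl.
move=> [d d0 hd]; exists (d / (`|c| + 1)) => [|z]; first by rewrite divr_gt0.
rewrite ltr_pdivlMr// => zx; apply: hd; rewrite opprD addrACA subrr addr0.
rewrite -scalerBr enormZ; apply: le_lt_trans zx.
by rewrite mulrC ler_wpM2l ?enorm_ge0// lerDl.
Qed.

Lemma continuous_shift (f : 'rV[R]_n -> R) y : continuous f ->
  continuous (fun x => f (x + y)).
Proof.
move=> cf; have := @continuous_affine f 1 y cf.
by under [X in continuous X -> _]eq_fun do rewrite scale1r.
Qed.

Lemma eball_compact (r : R) : compact [set x : 'rV[R]_n | enorm x <= r].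
Proof.
apply: bounded_closed_compact.
  exists r; split; first exact: num_real.
  move=> s rs x /= xr; apply: (le_trans (norm_le_enorm _)).
  by apply: (le_trans xr); exact: ltW.
apply: (@closed_comp _ _ (@enorm R n) [set t | t <= r]).
  by move=> x _; exact: enorm_continuous.
exact: closed_le.
Qed.

Lemma min_on_eball (f : 'rV[R]_n -> R) y0 (r : R) : 0 <= r -> continuous f ->
  exists2 x, enorm (x - y0) <= r &
    forall y, enorm (y - y0) <= r -> f x <= f y.
Proof.
move=> r0 cf.
have [||| x] := @EVT_min_rV R n (fun y => f (y + y0)) [set x | enorm x <= r].
- by exists 0; rewrite /= enorm0.
- exact: eball_compact.
- by apply: continuous_subspaceT; exact: continuous_shift.
rewrite inE /= => xr h; exists (x + y0); first by rewrite addrK.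
by move=> y yr; have := h (y - y0); rewrite subrK; apply; rewrite inE.
Qed.

Lemma continuous_add (f g : 'rV[R]_n -> R) : continuous f -> continuous g ->
  continuous (fun x => f x + g x).
Proof.
move=> cf cg; apply: continuous_enorm => x e e0.
have e2 : 0 < e / 2 by rewrite divr_gt0.
have [a a0 ha] := continuous_enormP cf x e2.
have [b b0 hb] := continuous_enormP cg x e2.
exists (Num.min a b) => [|y]; first by rewrite lt_min a0.
rewrite lt_min => /andP[/ha fa /hb gb].
by move: fa gb; rewrite !ltr_norml; lra.
Qed.

Lemma continuous_scale (f : 'rV[R]_n -> R) c : continuous f ->
  continuous (fun x => c * f x).
Proof.
move=> cf; apply: continuous_enorm => x e e0.
have c0 : 0 < `|c| + 1 by rewrite ltr_wpDl.
have [a a0 ha] := continuous_enormP cf x (divr_gt0 e0 c0).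
exists a => // y /ha; rewrite ltr_pdivlMr// => fa.
rewrite -mulrBr normrM; apply: le_lt_trans fa.
by rewrite mulrC ler_wpM2l// lerDl.
Qed.

Lemma continuous_enorm_sq y0 :
  continuous (fun x : 'rV[R]_n => enorm (x - y0) ^+ 2).
Proof.
move=> x; have -> : (fun x : 'rV[R]_n => enorm (x - y0) ^+ 2) =
    (fun t => t ^+ 2) \o (fun x => enorm (x - y0)) by [].
apply: continuous_comp; first by apply: continuous_shift; exact: enorm_continuous.
exact: exprn_continuous.
Qed.

Lemma min_penalized (f : 'rV[R]_n -> R) M k y0 : continuous f ->
  (forall x, `|f x| <= M) -> 0 < k ->
  exists x, forall y,
    f x + k * enorm (x - y0) ^+ 2 <= f y + k * enorm (y - y0) ^+ 2.
Proof.
move=> cf fM k0; have M0 : 0 <= M by exact: le_trans (normr_ge0 _) (fM 0).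
(* Beyond this radius the penalty is at least [2 * M], the largest possible oscillation of [f], so
   the minimum over the ball is global. *)
pose r := Num.sqrt (2 * M / k).
have r2 : k * r ^+ 2 = 2 * M.
  by rewrite sqr_sqrtr ?divr_ge0 ?mulr_ge0 ?(ltW k0)// mulrC divfK ?gt_eqF.
have [||x xr h] := @min_on_eball (fun x => f x + k * enorm (x - y0) ^+ 2) y0 r.
- exact: sqrtr_ge0.
- apply: continuous_add => //; apply: continuous_scale.
  exact: continuous_enorm_sq.
exists x => y; have [/h//|ry] := leP (enorm (y - y0)) r.
have /h : enorm (y0 - y0) <= r by rewrite subrr enorm0 sqrtr_ge0.
rewrite subrr enorm0 expr0n mulr0 addr0 => h0; apply: (le_trans h0).
have /ltW := ry; rewrite -(@ler_pXn2r _ 2) ?nnegrE ?sqrtr_ge0 ?enorm_ge0//.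
rewrite -(ler_pM2l k0) r2 => h1.
have := fM y; have := fM y0; rewrite !ler_norml; lra.
Qed.

End Euclid.

(** * Paraboloids as test functions *)

Section Quadratic.
Context {R : realType} {n : nat}.
Implicit Types (x y z p q : 'rV[R]_n) (u w : 'rV[R]_n -> R).

Lemma is_diff_coord (i : 'I_n) x :
  is_diff x (fun y : 'rV[R]_n => y 0 i) (fun y : 'rV[R]_n => y 0 i).
Proof.
have @f : {linear 'rV[R]_n -> R}.
  by exists (fun y : 'rV[R]_n => y 0 i); do 2![eexists]; do ?[constructor];
     rewrite ?mxE// => ? *; rewrite ?mxE//; move=> ?; rewrite !mxE.
rewrite (_ : (fun _ => _) = f)//.
have cf : continuous f by exact: coord_continuous.
by apply: DiffDef; [exact: linear_differentiable|rewrite diff_lin].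
Qed.

Lemma is_diff_sum (I : Type) (r : seq I) (f df : I -> 'rV[R]_n -> R) x :
  (forall i, is_diff x (f i) (df i)) ->
  is_diff x (\sum_(i <- r) f i) (\sum_(i <- r) df i).
Proof.
move=> h; elim: r => [|i r ih]; first by rewrite !big_nil; exact: is_diff_cst.
by rewrite !big_cons; exact: is_diffD.
Qed.

Definition quad x0 q c x : R := dot q (x - x0) + c * enorm (x - x0) ^+ 2.

Lemma is_diff_quad x0 q c x : is_diff x (quad x0 q c)
  (fun h => dot (q + (2 * c) *: (x - x0)) h).
Proof.
pose T i : 'rV[R]_n -> R := (fun y => y 0 i) - cst (x0 0 i).
have -> : quad x0 q c = \sum_(i < n) (q 0 i *: T i + c *: (T i * T i)).
  apply/funext => y; rewrite /quad -dotxx /dot mulr_sumr -big_split /= fct_sumE.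
  by apply: eq_bigr => i _; rewrite !mxE.
pose dT (i : 'I_n) : 'rV[R]_n -> R := (fun y => y 0 i) - 0.
have -> : (fun h => dot (q + (2 * c) *: (x - x0)) h) =
  \sum_(i < n) (q 0 i *: dT i + c *: (T i x *: dT i + T i x *: dT i)).
  apply/funext => y; rewrite /dot fct_sumE; apply: eq_bigr => i _.
  rewrite !mxE /dT /T /=.
  rewrite -![in RHS]/(_ * _).
  rewrite -[LHS]/((q 0 i + 2 * c * (x 0 i - x0 0 i)) * y 0 i).
  rewrite -[RHS]/(q 0 i * (y 0 i - 0) + c * ((x 0 i - x0 0 i) * (y 0 i - 0) +
     (x 0 i - x0 0 i) * (y 0 i - 0))).
  by ring.
apply: is_diff_sum => i.
have dTi : is_diff x (T i) (dT i) by apply: is_diffB; exact: is_diff_coord.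
by apply: is_diffD; apply: is_diffZ; exact: is_diffM.
Qed.

Lemma grad_quad x0 q c x : grad (quad x0 q c) x = q + (2 * c) *: (x - x0).
Proof.
apply/rowP => j; rewrite mxE (@diff_val _ _ _ _ _ _ _ (is_diff_quad x0 q c x)).
rewrite /dot (bigD1 j)//= big1 ?addr0; last first.
  by move=> i /negPf ij; rewrite [in X in _ * X]mxE eqxx ij mulr0.
by rewrite [in X in _ * X]mxE !eqxx mulr1.
Qed.

Lemma C1_quad x0 q c : C1 (quad x0 q c).
Proof.
split=> [x|]; first exact: (@ex_diff _ _ _ _ _ _ _ (is_diff_quad x0 q c x)).
have -> : grad (quad x0 q c) = (fun x => q + (2 * c) *: (x - x0)).
  by apply/funext => x; exact: grad_quad.
move=> x; apply/(@cvgrPdist_lt _ _ _ _ (nbhs_filter (x : 'rV[R]_n))) => e e0.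
have c0 : 0 < `|2 * c| + 1 by rewrite ltr_wpDl.
apply: (@filterS _ _ (nbhs_filter x) _ _ _ (enorm_nbhs x (divr_gt0 e0 c0))) => y.
rewrite ltr_pdivlMr// => yx; rewrite opprD addrACA subrr add0r -scalerBr.
rewrite opprB addrA subrK normrZ; apply: le_lt_trans yx; rewrite mulrC.
rewrite -normrN opprB ler_pM//; first exact: norm_le_enorm.
by rewrite lerDl.
Qed.

(* Since grad (quad x0 q c) x0 = q, touching by a paraboloid already yields the
   viscosity inequality with gradient q; no other test function is ever used. *)
Definition touch_above u x q c :=
  \forall y \near x, u y <= u x + dot q (y - x) + c * enorm (y - x) ^+ 2.

Definition touch_below u x q c :=
  \forall y \near x, u x + dot q (y - x) - c * enorm (y - x) ^+ 2 <= u y.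

Lemma touch_aboveW u x q c :
  (forall y, u y <= u x + dot q (y - x) + c * enorm (y - x) ^+ 2) ->
  touch_above u x q c.
Proof. exact: (@filterE _ _ (nbhs_filter x)). Qed.

Lemma touch_belowW u x q c :
  (forall y, u x + dot q (y - x) - c * enorm (y - x) ^+ 2 <= u y) ->
  touch_below u x q c.
Proof. exact: (@filterE _ _ (nbhs_filter x)). Qed.

Lemma quad0 x0 q c : quad x0 q c x0 = 0.
Proof. by rewrite /quad subrr dot0r enorm0 expr0n mulr0 addr0. Qed.

Lemma sub_touch F u x q c : viscosity_subsolution F u ->
  touch_above u x q c -> F x (u x) q <= 0.
Proof.
move=> /(_ (quad x q c) x (C1_quad x q c)); rewrite grad_quad subrr scaler0 addr0.
move=> h tu; apply: h; apply: (@filterS _ _ (nbhs_filter x) _ _ _ tu) => y.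
rewrite quad0 /quad; lra.
Qed.

Lemma super_touch F u x q c : viscosity_supersolution F u ->
  touch_below u x q c -> 0 <= F x (u x) q.
Proof.
move=> /(_ (quad x q (- c)) x (C1_quad x q (- c))).
rewrite grad_quad subrr scaler0 addr0.
move=> h tu; apply: h; apply: (@filterS _ _ (nbhs_filter x) _ _ _ tu) => y.
rewrite quad0 /quad; lra.
Qed.

End Quadratic.

(** * Sup-convolution and convexity *)

Section SupConvolution.
Context {R : realType} {n : nat}.
Implicit Types (x y z p q : 'rV[R]_n) (u w U : 'rV[R]_n -> R) (k M : R).

Definition semiconvex_at w y q k :=
  forall z, w y + dot q (z - y) - k * enorm (z - y) ^+ 2 <= w z.

(** The sup-convolution of [U], stated as a relation with the supremum attained; the point where it
    is attained carries the viscosity information. *)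
Definition is_supconv k U w :=
  (forall y z, U z - k * enorm (z - y) ^+ 2 <= w y) /\
  (forall y, exists z, w y = U z - k * enorm (z - y) ^+ 2).

Lemma supconv_exists U M k : continuous U -> (forall x, `|U x| <= M) -> 0 < k ->
  exists w, is_supconv k U w.
Proof.
move=> cU UM k0.
have /choice[z hz] : forall y, exists z, forall z',
    U z' - k * enorm (z' - y) ^+ 2 <= U z - k * enorm (z - y) ^+ 2.
  move=> y; have [||z hz] := @min_penalized R n (fun x => - U x) M k y _ _ k0.
  - by under eq_fun do rewrite -mulN1r; exact: continuous_scale.
  - by move=> x; rewrite normrN.
  by exists z => z'; have := hz z'; lra.
exists (fun y => U (z y) - k * enorm (z y - y) ^+ 2); split=> // y.
by exists (z y).
Qed.

(** Expanding the square around the maximiser [z] gives both jets with the same vector: with the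
    centre [y] fixed, a paraboloid touches [U] from above at [z]; with [z] fixed and the centre
    moving, a paraboloid stays below [w]. So an inequality for [U] at [z] becomes one for a
    subgradient of [w] at [y]. *)
Lemma supconv_jet k U w y : 0 < k -> is_supconv k U w ->
  exists z q, [/\ q = (2 * k) *: (z - y),
    forall x, U x <= U z + dot q (x - z) + k * enorm (x - z) ^+ 2,
    semiconvex_at w y q k, U y <= w y & w y <= U z].
Proof.
move=> k0 [wge /(_ y)[z wz]]; exists z, ((2 * k) *: (z - y)); split=> //.
- move=> x; have := wge y x.
  have := enorm_sqD (x - z) (z - y); rewrite addrA subrK dotC wz dotZl.
  by move=> ->; lra.
- move=> x; have := wge x z.
  have := enorm_sqD (z - y) (y - x); rewrite addrA subrK wz dotZl (enormB x y).
  by rewrite -(opprB y x) dotNr => ->; lra.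
- by have := wge y y; rewrite subrr enorm0 expr0n mulr0 subr0.
- by rewrite wz gerBl mulr_ge0 ?sqr_ge0 ?(ltW k0).
Qed.

Lemma supconv_bounded k U w M : 0 < k -> is_supconv k U w ->
  (forall x, `|U x| <= M) -> forall x, `|w x| <= M.
Proof.
move=> k0 sw UM x; have [z [q [_ _ _ h1 h2]]] := supconv_jet x k0 sw.
by have := UM x; have := UM z; rewrite !ler_norml; lra.
Qed.

Lemma supconv_periodic k U w : is_supconv k U w -> Zperiodic U -> Zperiodic w.
Proof.
move=> [wge weq] UP.
have UP' y (m : 'rV[int]_n) : U (y - map_mx intr m) = U y.
  by rewrite -[in RHS](subrK (map_mx intr m) y) UP.
have le_shift y (m : 'rV[int]_n) : w (y + map_mx intr m) <= w y.
  have [z ->] := weq (y + map_mx intr m).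
  have := wge y (z - map_mx intr m).
  by rewrite UP' opprD addrA addrAC.
move=> y m; apply/le_anti; rewrite le_shift/=.
have := le_shift (y + map_mx intr m) (- m).
suff -> : y + map_mx intr m + map_mx intr (- m) = y by [].
by apply/rowP => i; rewrite !mxE intrN; ring.
Qed.

(** The constant is exactly [L], whatever [k]: cutting the segment into m equal pieces divides the
    total quadratic error by m, and m is arbitrary. *)
Lemma semiconvex_lipschitz w k L :
  (forall y, exists2 q, enorm q <= L & semiconvex_at w y q k) ->
  forall x y, `|w y - w x| <= L * enorm (y - x).
Proof.
move=> h.
have L0 : 0 <= L by have [q ? _] := h 0; exact: le_trans (enorm_ge0 q) _.
have step x y : w x - w y <= L * enorm (y - x) + k * enorm (y - x) ^+ 2.
  have [q qL /(_ y)] := h x.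
  have := dot_norm q (y - x); rewrite ler_norml => /andP[+ _].
  have : enorm q * enorm (y - x) <= L * enorm (y - x).
    by rewrite ler_wpM2r ?enorm_ge0.
  lra.
have chain x d m : w x - w (x + m%:R *: d) <=
    m%:R * (L * enorm d + k * enorm d ^+ 2).
  elim: m => [|m ih]; first by rewrite scale0r addr0 subrr mul0r.
  have := step (x + m%:R *: d) (x + m.+1%:R *: d).
  have -> : x + m.+1%:R *: d - (x + m%:R *: d) = d.
    by rewrite opprD addrACA subrr add0r -scalerBl -natrB// subSnn scale1r.
  by rewrite -natr1; lra.
have half x y : w x - w y <= L * enorm (y - x).
  rewrite -subr_le0 leNgt; apply/negP => e0.
  set e := w x - w y - L * enorm (y - x) in e0.
  have [m hm] : exists m : nat, k * enorm (y - x) ^+ 2 < m.+1%:R * e.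
    exists (Num.truncn (`|k * enorm (y - x) ^+ 2| / e)).
    rewrite -ltr_pdivrMr//.
    apply: le_lt_trans (truncnS_gt _).
    by rewrite ler_pM2r ?invr_gt0// ler_norm.
  have m0 : 0 < m.+1%:R :> R by [].
  have := chain x (m.+1%:R^-1 *: (y - x)) m.+1.
  rewrite scalerA divff ?gt_eqF// scale1r (addrC x) subrK enormZ.
  rewrite gtr0_norm ?invr_gt0//; move: hm; rewrite /e.
  move: (enorm (y - x)) (w x - w y) m.+1%:R m0 => D W t t0 hm.
  have -> : t * (L * (t^-1 * D) + k * (t^-1 * D) ^+ 2) = L * D + k * D ^+ 2 / t.
    by field; rewrite gt_eqF.
  by rewrite -lerBlDl ler_pdivlMr//; lra.
move=> x y; rewrite ler_norml.
have := half x y; have := half y x; rewrite (enormB x y); lra.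
Qed.

(** Comparing the maximiser with [y] itself gives |z - y|^2 / (2 S) <= L |z - y|. This serves for
    averages, which satisfy no viscosity inequality from which a bound on [q] could be read. *)
Lemma supconv_lipschitz_jet U w L (S : R) y : 0 <= L -> 0 < S ->
  is_supconv (1 / (2 * S)) U w ->
  (forall x z, `|U z - U x| <= L * enorm (z - x)) ->
  exists z q, [/\ enorm q <= 2 * L, enorm (z - y) <= 2 * L * S,
    forall x, U x <= U z + dot q (x - z) + 1 / (2 * S) * enorm (x - z) ^+ 2,
    semiconvex_at w y q (1 / (2 * S)) & U y <= w y /\ w y <= U z].
Proof.
move=> L0 S0 sw UL; have k0 : 0 < 1 / (2 * S) by rewrite divr_gt0 ?mulr_gt0.
have [z [q [qE tz sc Uw wU]]] := supconv_jet y k0 sw.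
have qE' : q = S^-1 *: (z - y).
  by rewrite qE; congr (_ *: _); field; rewrite gt_eqF.
have zy : enorm (z - y) <= 2 * L * S.
  have := tz y; have := UL y z; rewrite ler_norml => /andP[_ h1] h2.
  move: h2; rewrite qE' -(opprB z y) dotNr dotZl dotxx enormN.
  move: h1; set D := enorm (z - y) => h1 h2.
  have D0 : 0 <= D by exact: enorm_ge0.
  have [->|Dn0] := eqVneq D 0; first by rewrite !mulr_ge0// ltW.
  have Dp : 0 < D by rewrite lt0r Dn0.
  have h3 : S^-1 * D ^+ 2 / 2 <= L * D.
    have e1 : 1 / (2 * S) * D ^+ 2 = S^-1 * D ^+ 2 / 2 by field; rewrite gt_eqF.
    lra.
  have : D * D <= (2 * L * S) * D.
    have := ler_wpM2l (ltW S0) h3.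
    have -> : S * (S^-1 * D ^+ 2 / 2) = D ^+ 2 / 2 by field; rewrite gt_eqF.
    lra.
  by rewrite ler_pM2r.
exists z, q; split=> //.
by rewrite qE' enormZ gtr0_norm ?invr_gt0// mulrC ler_pdivrMr.
Qed.

End SupConvolution.

(** * Jensen's inequality and Lipschitz bounds for convex functions *)

Section Convex.
Context {R : realType} {n : nat}.
Variable f : 'rV[R]_n -> R.
Hypothesis fconvex : convex_function (E := 'rV[R]_n) [set: 'rV[R]_n] f.
Implicit Types p q : 'rV[R]_n.

Lemma convex_ineq p q (t : R) : 0 <= t <= 1 ->
  f (t *: p + (1 - t) *: q) <= t * f p + (1 - t) * f q.
Proof.
move=> t01.
have ti : Itv.spec (@Itv.num_sem R) (Itv.Real `[0%Z, 1%Z]) t.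
  rewrite /Itv.num_sem /= /Itv.num_sem; apply/andP; split.
    by apply: ger0_real; case/andP: t01.
  by rewrite in_itv /=.
have := @fconvex (Itv.mk ti) p q; rewrite !inE; exact.
Qed.

Lemma convex_jensen (I : finType) (a : I -> R) (p : I -> 'rV[R]_n) :
  (forall i, 0 <= a i) -> \sum_i a i = 1 ->
  f (\sum_i a i *: p i) <= \sum_i a i * f (p i).
Proof.
move=> a0 a1.
(* Partial weights do not sum to 1, so the induction runs on the normalised inequality; a tail of
   zero total weight is treated apart. *)
have main (r : seq I) : let s := \sum_(i <- r) a i in 0 < s ->
    f (s^-1 *: \sum_(i <- r) a i *: p i) <= s^-1 * \sum_(i <- r) a i * f (p i).
  elim: r => [|i r ih] /=; first by rewrite big_nil ltxx.
  rewrite !big_cons; set s := \sum_(j <- r) a j => ais.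
  have : 0 <= s by exact: sumr_ge0.
  rewrite le_eqVlt => /orP[/eqP s0|s0].
    have z j : j \in r -> a j = 0.
      move=> jr; apply/eqP; rewrite eq_le a0 andbT s0 /s (big_rem j)//= lerDl.
      exact: sumr_ge0.
    have -> : \sum_(j <- r) a j *: p j = 0.
      by rewrite big_seq big1// => j /z ->; rewrite scale0r.
    have -> : \sum_(j <- r) a j * f (p j) = 0.
      by rewrite big_seq big1// => j /z ->; rewrite mul0r.
    rewrite -s0 !addr0 scalerA mulVf ?scale1r; last by rewrite gt_eqF// -[a i]addr0 [X in _ + X]s0.
    by rewrite mulrA mulVf ?mul1r// gt_eqF// -[a i]addr0 [X in _ + X]s0.
  have := @convex_ineq (p i) (s^-1 *: \sum_(j <- r) a j *: p j) (a i / (a i + s)).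
  have e : 1 - a i / (a i + s) = s / (a i + s) by field; rewrite gt_eqF.
  rewrite e scalerA.
  have -> : s / (a i + s) * s^-1 = (a i + s)^-1.
    by field; rewrite !gt_eqF.
  rewrite scalerDr scalerA [(a i + s)^-1 * a i]mulrC => h.
  have ai1 : 0 <= a i / (a i + s) <= 1.
    by rewrite divr_ge0 ?a0 ?(ltW ais)//= ler_pdivrMr// mul1r lerDl ltW.
  apply: (le_trans (h ai1)) => {h ai1}.
  rewrite [leRHS]mulrDr mulrA [(a i + s)^-1 * a i]mulrC lerD2l.
  have := ler_wpM2l (ltW s0) (ih s0).
  rewrite mulrA divff ?gt_eqF// mul1r => h2.
  by rewrite (mulrC s) -mulrA ler_wpM2l// invr_ge0 ltW.
by have := main (index_enum I); rewrite /= a1 invr1 scale1r mul1r; apply.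
Qed.

(** Extend the segment from [q] through [p] by a unit length to [e]; then [p] is a convex
    combination of [e] and [q], and the slope is at most the oscillation [2 * M] over that unit
    length. *)
Lemma convex_lipschitz M r : (forall p, enorm p <= r + 1 -> `|f p| <= M) ->
  forall p q, enorm p <= r -> enorm q <= r ->
    f p - f q <= 2 * M * enorm (p - q).
Proof.
move=> fM p q pr qr; have [/eqP pq|] := boolP (p == q).
  by rewrite pq !subrr enorm0 mulr0.
rewrite -subr_eq0 => pq; set d := enorm (p - q).
have d0 : 0 < d.
  by rewrite lt0r enorm_ge0 andbT; apply: contra pq => /eqP /enorm_eq0 ->.
have d1 : 0 < 1 + d by rewrite addr_gt0.
pose e := p + d^-1 *: (p - q).
have er : enorm e <= r + 1.
  apply: (le_trans (enormD _ _)); rewrite lerD// enormZ gtr0_norm ?invr_gt0//.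
  by rewrite mulVf ?gt_eqF.
have := @convex_ineq e q (d / (1 + d)).
have -> : 1 - d / (1 + d) = (1 + d)^-1 by field; rewrite gt_eqF.
have -> : (d / (1 + d)) *: e + (1 + d)^-1 *: q = p.
  apply/rowP => i; rewrite /e !mxE; move: (p 0 i) (q 0 i) => a b; field.
  by rewrite !gt_eqF.
move=> h.
have h1 : f p <= d / (1 + d) * f e + (1 + d)^-1 * f q.
  by apply: h; rewrite divr_ge0 ?(ltW d0) ?(ltW d1)//= ler_pdivrMr// mul1r lerDr.
have h2 : f p - f q <= (d / (1 + d)) * (f e - f q).
  apply: (le_trans (lerB h1 (lexx (f q)))).
  rewrite le_eqVlt; apply/orP; left; apply/eqP; field; by rewrite gt_eqF.
apply: (le_trans h2).
have M2 : f e - f q <= 2 * M.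
  have := fM e er; have : `|f q| <= M by apply: fM; rewrite (le_trans qr)// lerDl.
  by rewrite !ler_norml; lra.
have M0 : 0 <= M by apply: le_trans (normr_ge0 _) (fM e er).
have dd : d / (1 + d) <= d by rewrite ler_pdivrMr// ler_peMr// ?lerDl ltW.
apply: (@le_trans _ _ (d / (1 + d) * (2 * M))).
  by rewrite ler_wpM2l// divr_ge0 ?(ltW d0) ?(ltW d1).
by rewrite mulrC ler_wpM2l// mulr_ge0.
Qed.

End Convex.

(** * Periodic functions and the cell problem *)

Section Periodic.
Context {R : realType} {n : nat}.
Implicit Types (x y z p q : 'rV[R]_n) (u v w g : 'rV[R]_n -> R).
Local Notation Zv k := (map_mx intr k : 'rV[R]_n).

Lemma lattice_reduction x y : exists k : 'rV[int]_n,
  enorm (x - Zv k - y) <= n%:R.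
Proof.
exists (\row_i Num.floor (x 0 i - y 0 i)).
rewrite -[leRHS]mulr1; apply: enorm_le_coord => i; rewrite !mxE.
have /andP[] := floor_itv (x 0 i - y 0 i); rewrite intrD1 => h1 h2.
by rewrite ler_norml; lra.
Qed.

Lemma periodic_min u : continuous u -> Zperiodic u ->
  exists x, forall y, u x <= u y.
Proof.
move=> cu pu; have [x _ hx] := @min_on_eball R n u 0 n%:R (ler0n _ _) cu.
exists x => y; have [k hk] := lattice_reduction y 0.
by rewrite -(subrK (Zv k) y) pu; exact: hx.
Qed.

Lemma periodic_bounded u : continuous u -> Zperiodic u ->
  exists M, forall x, `|u x| <= M.
Proof.
move=> cu pu; have [x hx] := periodic_min cu pu.
have [||z hz] := @periodic_min (fun y => -1 * u y); first exact: continuous_scale.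
  by move=> y k; rewrite pu.
exists (`|u x| + `|u z|) => y; have := hx y; have := hz y.
have := ler_norm (u z); have := ler_norm (- u x); rewrite normrN.
have := normr_ge0 (u x); have := normr_ge0 (u z).
by rewrite ler_norml; lra.
Qed.

(** The lower paraboloid of [w], corrected by the gradient of the penalty, is transferred to [v]; no
    regularity of [v] is involved. *)
Lemma min_touch v w x q y0 c k :
  (forall y, v x - w x + k * enorm (x - y0) ^+ 2 <=
             v y - w y + k * enorm (y - y0) ^+ 2) ->
  semiconvex_at w x q c -> touch_below v x (q - (2 * k) *: (x - y0)) (c + k).
Proof.
move=> h sw; apply: touch_belowW => y; have := h y; have := sw y.
have := enorm_sqD (y - x) (x - y0); rewrite addrA subrK => ->.
by rewrite [dot (q - _) _]dotDl dotNl dotZl (dotC (x - y0)); lra.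
Qed.

(** A comparison on the torus for a [g] that is not of the form affine plus periodic but misses it
    by [a]. The defect grows quadratically in the lattice vector, so a quadratic penalty of the same
    order localises the contact point, and its gradient is the error [e]. *)
Lemma cell_compare (F : 'rV[R]_n -> 'rV[R]_n -> R) p b v g y0 a :
  continuous v -> Zperiodic v ->
  viscosity_supersolution (fun y _ q => F y (p + q) - b) v ->
  continuous g -> 0 < a ->
  (forall y k, enorm (y - y0) <= n%:R ->
     g (y + Zv k) <= g y + dot p (Zv k) + a * (enorm (Zv k) + enorm (Zv k) ^+ 2)) ->
  exists2 y, enorm (y - y0) <= 5 * n%:R + 1 & forall q c, semiconvex_at g y q c ->
    exists2 e, enorm e <= 4 * a * (5 * n%:R + 1) & b <= F y (q - e).
Proof.
move=> cv pv sv cg a0 hg.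
pose f y := v y + dot p y - g y + 2 * a * enorm (y - y0) ^+ 2.
have cf : continuous f.
  apply: continuous_add; last by apply: continuous_scale; exact: continuous_enorm_sq.
  apply: continuous_add; last by under eq_fun do rewrite -mulN1r; exact: continuous_scale.
  apply: continuous_add => //; apply: (@lipschitz_continuous _ _ _ (enorm p)).
  by move=> y z; rewrite -dotNr -dotDr dot_norm.
have r0 : 0 <= 5 * n%:R + 1 :> R by rewrite addr_ge0 ?mulr_ge0.
have [y yr hy] := min_on_eball y0 r0 cf.
have fmin z : f y <= f z.
  have [k hk] := lattice_reduction z y0; set z' := z - Zv k in hk.
  have zE : z = z' + Zv k by rewrite subrK.
  have n0 : 0 <= n%:R :> R by [].
  (* With K the length of the lattice vector, the penalty of weight 2 a gains at least 2 a (K^2 - 2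
     n K) and the defect of [g] loses at most a (K + K^2). The balance is nonnegative once K >= 4 n
     + 1; adding the diameter bound n of a cell gives the radius 5 n + 1. *)
  have [kr|kr] := leP (enorm (Zv k)) (4 * n%:R + 1).
    apply: hy; rewrite zE addrAC; apply: (le_trans (enormD _ _)).
    by move: kr hk n0; set N := n%:R; lra.
  have /le_trans : f y <= f z' by apply: hy; move: hk n0; set N := n%:R; lra.
  apply; rewrite zE /f pv dotDr (addrAC z').
  have -> := enorm_sqD (z' - y0) (Zv k).
  have := hg z' k hk; have := dot_norm (z' - y0) (Zv k).
  rewrite ler_norml => /andP[+ _].
  have := ler_wpM2r (enorm_ge0 (Zv k)) hk.
  move: kr n0; move: (enorm (Zv k)) (enorm (z' - y0)) (dot (z' - y0) (Zv k)) => K Z D.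
  set N := n%:R => kr n0 h1 h2 h3.
  have h4 : 0 <= a * K * (K - 4 * N - 1) by rewrite !mulr_ge0 ?ltW//; lra.
  have h5 : 0 <= a * (D + N * K) by rewrite mulr_ge0 ?(ltW a0)//; lra.
  by lra.
exists y => // q c sg; exists ((4 * a) *: (y - y0)).
  by rewrite enormZ gtr0_norm ?mulr_gt0// ler_wpM2l// mulr_ge0// ltW.
pose w z := g z - dot p z.
have /(min_touch (v := v) (y0 := y0) (k := 2 * a)) : semiconvex_at w y (q - p) c.
  by move=> z; have := sg z; rewrite /w !dotE; lra.
have hv : forall z, v y - w y + 2 * a * enorm (y - y0) ^+ 2 <=
   v z - w z + 2 * a * enorm (z - y0) ^+ 2.
  by move=> z; have := fmin z; rewrite /f /w; lra.
move=> /(_ hv) /(super_touch sv); rewrite subr_ge0.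
rewrite addrA (addrC p) subrK; suff -> : 2 * (2 * a) = 4 * a by [].
by ring.
Qed.

Section Effective.
Variables (H : 'rV[R]_n -> 'rV[R]_n -> 'rV[R]_n -> R) (x p : 'rV[R]_n) (b : R).
Hypothesis hb : cell_problem_solvable H x p b.

(** At a minimum of the corrector the zero gradient is admissible, so the cell equation is tested at
    [p] itself. The next lemma uses a maximum in the same way. *)
Lemma effective_le M : (forall y, H x y p <= M) -> b <= M.
Proof.
move=> hM; have [v [pv [cv _ sv]]] := hb.
have [y hy] := periodic_min cv pv.
have : touch_below v y 0 0.
  by apply: touch_belowW => z; have := hy z; rewrite dotC dot0r mul0r; lra.
by move=> /(super_touch sv); rewrite addr0; have := hM y; lra.
Qed.

Lemma effective_ge M : (forall y, M <= H x y p) -> M <= b.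
Proof.
move=> hM; have [v [pv [cv sv _]]] := hb.
have [||y hy] := @periodic_min (fun y => -1 * v y); first exact: continuous_scale.
  by move=> y k; rewrite pv.
have : touch_above v y 0 0.
  by apply: touch_aboveW => z; have := hy z; rewrite dotC dot0r mul0r; lra.
by move=> /(sub_touch sv); rewrite addr0; have := hM y; lra.
Qed.

End Effective.

End Periodic.

(** * Product weights and box averages *)

Section ProductWeights.
Context {R : comPzRingType} {n : nat} {J : finType}.
Implicit Types (b : 'I_n -> J -> R) (k : {ffun 'I_n -> J}) (i : 'I_n).

Definition prodw b k : R := \prod_i b i (k i).

Definition upd k i (j : J) : {ffun 'I_n -> J} :=
  [ffun l => if l == i then j else k l].

Lemma upd_same k i j : upd k i j i = j. Proof. by rewrite ffunE eqxx. Qed.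

Lemma upd_upd k i j : upd (upd k i j) i (k i) = k.
Proof. by apply/ffunP => l; rewrite !ffunE; case: eqP => [->|]. Qed.

Lemma sum_prodw b : \sum_k prodw b k = \prod_i \sum_j b i j.
Proof. by rewrite bigA_distr_bigA. Qed.

Lemma sum_prodw1 b : (forall i, \sum_j b i j = 1) -> \sum_k prodw b k = 1.
Proof. by move=> b1; rewrite sum_prodw big1. Qed.

Lemma prodw_upd b k i j : prodw b (upd k i j) = b i j * \prod_(l | l != i) b l (k l).
Proof.
rewrite /prodw (bigD1 i)//= upd_same; congr (_ * _).
by apply: eq_bigr => l /negPf li; rewrite ffunE li.
Qed.

(** Replacing the factor of coordinate [i] by arbitrary, possibly signed, coefficients [c] amounts
    to resampling that coordinate. This reduces estimates on product weights to one dimension. *)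
Lemma sum_coordinate b i (c : J -> R) (G : {ffun 'I_n -> J} -> R) :
  \sum_j b i j = 1 ->
  \sum_(k : {ffun 'I_n -> J}) (c (k i) * \prod_(l | l != i) b l (k l)) * G k =
  \sum_k prodw b k * \sum_j c j * G (upd k i j).
Proof.
move=> b1.
under [RHS]eq_bigr do rewrite mulr_sumr.
rewrite pair_bigA /=.
(* The involution swaps coordinate [i] of the index with the extra variable; the freed sum over that
   variable is then 1. *)
pose h (kj : {ffun 'I_n -> J} * J) := (upd kj.1 i kj.2, kj.1 i).
have hK : involutive h.
  by move=> [k j]; rewrite /h /= upd_upd upd_same.
rewrite (reindex_inj (inv_inj hK)) /=.
rewrite -(pair_bigA _ (fun (k : {ffun 'I_n -> J}) (j : J) => prodw b (upd k i j) *
  (c (k i) * G (upd (upd k i j) i (k i))))) /=.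
apply: eq_bigr => k _.
under [RHS]eq_bigr do rewrite upd_upd prodw_upd -mulrA.
by rewrite -mulr_suml b1 mul1r mulrCA mulrA.
Qed.

End ProductWeights.

Lemma prodw_ge0 (R : numDomainType) n (J : finType) (b : 'I_n -> J -> R) k :
  (forall i j, 0 <= b i j) -> 0 <= prodw b k.
Proof. by move=> b0; apply: prodr_ge0. Qed.

Section BoxAverage.
Context {R : realType} {n : nat}.
Implicit Types (x y z p q : 'rV[R]_n) (u v w g d F : 'rV[R]_n -> R) (B D : R).
Local Notation Zv k := (map_mx intr k : 'rV[R]_n).
Local Notation e_ i := (delta_mx 0 i : 'rV[R]_n).

(** Walk along coordinate directions: the number of unit steps is the l^1 norm of [k], at most n
    times its Euclidean norm. *)
Lemma lattice_steps F B : (forall y i, `|F (y + e_ i) - F y| <= B) ->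
  forall y (k : 'rV[int]_n), `|F (y + Zv k) - F y| <= n%:R * B * enorm (Zv k).
Proof.
move=> h y k.
have hN z i m : `|F (z + m%:R *: e_ i) - F z| <= m%:R * B.
  elim: m => [|m ih]; first by rewrite scale0r addr0 subrr normr0 mul0r.
  have := h (z + m%:R *: e_ i) i.
  rewrite -addrA -{2}[e_ i]scale1r -scalerDl natr1 -natr1 mulrDl mul1r => h1.
  have := ler_normD (F (z + m.+1%:R *: e_ i) - F (z + m%:R *: e_ i))
                    (F (z + m%:R *: e_ i) - F z).
  by rewrite natr1 addrA subrK in h1 *; lra.
have hZ z i (m : int) : `|F (z + m%:~R *: e_ i) - F z| <= `|m%:~R| * B.
  case: m => m; first by rewrite -pmulrn normr_nat hN.
  rewrite NegzE intrN normrN -pmulrn normr_nat.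
  have := hN (z - m.+1%:R *: e_ i) i m.+1.
  by rewrite subrK scaleNr distrC.
have hs (r : seq 'I_n) :
    `|F (y + \sum_(i <- r) (k 0 i)%:~R *: e_ i) - F y| <=
    \sum_(i <- r) `|(k 0 i)%:~R| * B.
  elim: r => [|i r ih]; first by rewrite !big_nil addr0 subrr normr0.
  rewrite !big_cons; set s := \sum_(i <- r) _ *: _ in ih *.
  have := hZ (y + s) i (k 0 i); rewrite -addrA (addrC s) => h1.
  have := ler_normD (F (y + ((k 0 i)%:~R *: e_ i + s)) - F (y + s)) (F (y + s) - F y).
  by rewrite addrA subrK; lra.
have kE : Zv k = \sum_(i < n) (k 0 i)%:~R *: e_ i.
  by rewrite [LHS]row_sum_delta; apply: eq_bigr => i _; rewrite mxE.
have B0 (i : 'I_n) : 0 <= B by exact: le_trans (normr_ge0 _) (h 0 i).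
rewrite {1}kE; apply: (le_trans (hs _)).
rewrite -[X in _ <= X%:R * _ * _](card_ord n) -sum1_card natr_sum mulr_suml.
rewrite mulr_suml; apply: ler_sum => i _; rewrite mul1r mulrC ler_wpM2l ?(B0 i)//.
by have := enorm_coord (Zv k) i; rewrite mxE.
Qed.

Variable N : nat.
Hypothesis N0 : (0 < N)%N.

Definition boxpt (k : {ffun 'I_n -> 'I_N}) : 'rV[R]_n := \row_i (k i)%:R.

Definition unifw : 'I_n -> 'I_N -> R := fun _ _ => N%:R^-1.

Definition boxavg (d : 'rV[R]_n -> R) y := \sum_k prodw unifw k * d (y + boxpt k).

Lemma unifw_ge0 i j : 0 <= unifw i j. Proof. by rewrite invr_ge0. Qed.

Lemma unifw_sum i : \sum_j unifw i j = 1.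
Proof. by rewrite sumr_const card_ord -[RHS](@mulVf _ N%:R) ?mulr_natr// pnatr_eq0 -lt0n. Qed.

Lemma boxpt_le k : enorm (boxpt k) <= n%:R * N%:R.
Proof.
apply: enorm_le_coord => i; rewrite mxE normr_nat ler_nat; exact/ltnW.
Qed.

(** Along direction [i] the difference of the two averages telescopes, leaving only two opposite
    faces of the box; each has weight 1 / N. *)
Lemma boxavg_shift d D : (forall y, `|d y| <= D) ->
  forall y i, `|boxavg d (y + e_ i) - boxavg d y| <= 2 * D / N%:R.
Proof.
move=> dD y i; rewrite /boxavg -sumrB.
under eq_bigr do rewrite -mulrBr.
have -> : \sum_k prodw unifw k * (d (y + e_ i + boxpt k) - d (y + boxpt k)) =
  \sum_(k : {ffun 'I_n -> 'I_N}) (unifw i (k i) * \prod_(l | l != i) unifw l (k l)) *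
    (d (y + e_ i + boxpt k) - d (y + boxpt k)).
  by apply: eq_bigr => k _; rewrite /prodw (bigD1 i).
rewrite sum_coordinate; last exact: unifw_sum.
apply: (le_trans (ler_norm_sum _ _ _)).
set c := 2 * D / N%:R.
rewrite -[leRHS]mul1r -(sum_prodw1 unifw_sum) mulr_suml; apply: ler_sum => k _.
have w0 := prodw_ge0 k unifw_ge0.
rewrite normrM (ger0_norm w0) ler_wpM2l//.
rewrite /unifw /c -mulr_sumr normrM ger0_norm ?invr_ge0// [leLHS]mulrC ler_wpM2r ?invr_ge0//.
pose z := boxpt k - (k i)%:R *: e_ i.
have zE (j : 'I_N) : boxpt (upd k i j) = z + (j : nat)%:R *: e_ i.
  apply/rowP => l; rewrite !mxE ffunE eqxx /=; case: eqVneq => [->|li].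
    by rewrite !mulr1 subrr add0r.
  by rewrite !mulr0 subr0 addr0.
rewrite (eq_bigr (fun j : 'I_N => d (y + z + (j.+1)%:R *: e_ i) -
    d (y + z + (j : nat)%:R *: e_ i))); last first.
  move=> j _; rewrite zE -natr1 scalerDl scale1r !addrA.
  by congr (d _ - _); rewrite -!addrA; congr (_ + _); rewrite addrC !addrA.
rewrite -(big_mkord xpredT (fun j => d (y + z + j.+1%:R *: e_ i) - d (y + z + j%:R *: e_ i))).
rewrite telescope_sumr//; apply: (le_trans (ler_normB _ _)).
by rewrite mulr2n mulrDl mul1r lerD.
Qed.

End BoxAverage.

Section BoxAverageIncrements.
Context {R : realType} {n : nat}.
Implicit Types (x y z p q : 'rV[R]_n) (B L : R) (N : nat).

Definition int_of_box N (k : {ffun 'I_n -> 'I_N}) : 'rV[int]_n :=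
  \row_i (k i : nat)%:Z.

Lemma boxptE N (k : {ffun 'I_n -> 'I_N}) :
  boxpt k = map_mx intr (int_of_box k) :> 'rV[R]_n.
Proof. by apply/rowP => i; rewrite !mxE. Qed.

Lemma average_bound (I : finType) (a f : I -> R) B : (forall i, 0 <= a i) ->
  \sum_i a i = 1 -> (forall i, `|f i| <= B) -> `|\sum_i a i * f i| <= B.
Proof.
move=> a0 a1 fB; apply: (le_trans (ler_norm_sum _ _ _)).
rewrite -[leRHS]mul1r -a1 mulr_suml; apply: ler_sum => i _.
by rewrite normrM ger0_norm// ler_wpM2l.
Qed.

Lemma boxavg_bound N (d : 'rV[R]_n -> R) B : (0 < N)%N -> (forall y, `|d y| <= B) ->
  forall y, `|boxavg N d y| <= B.
Proof.
move=> N0 dB y; apply: average_bound => [k||k]; last exact: dB.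
  exact: prodw_ge0 (unifw_ge0 (N := N)).
exact: sum_prodw1 (unifw_sum N0).
Qed.

Lemma boxavgB N (f g : 'rV[R]_n -> R) y :
  boxavg N f y - boxavg N g y = boxavg N (fun z => f z - g z) y.
Proof. by rewrite /boxavg -sumrB; apply: eq_bigr => k _; rewrite mulrBr. Qed.

Lemma boxavg_translate N (f : 'rV[R]_n -> R) y z :
  boxavg N f (y + z) = boxavg N (fun x => f (x + z)) y.
Proof. by apply: eq_bigr => k _; rewrite addrAC. Qed.

Lemma boxavg_lip N (f : 'rV[R]_n -> R) L : (0 < N)%N ->
  (forall y z, `|f z - f y| <= L * enorm (z - y)) ->
  forall y z, `|boxavg N f z - boxavg N f y| <= L * enorm (z - y).
Proof.
move=> N0 fL y z; have zE : y + (z - y) = z by rewrite addrC subrK.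
rewrite -{1}zE boxavg_translate boxavgB; apply: boxavg_bound => // x.
by have := fL x (x + (z - y)); rewrite (addrC x) addrK.
Qed.

(* Averaging over [N] lattice periods makes the increments along lattice vectors
   almost independent of the base point. *)
Lemma boxavg_increment N (f : 'rV[R]_n -> R) L y z (k : 'rV[int]_n) : (0 < N)%N ->
  (forall y z, `|f z - f y| <= L * enorm (z - y)) ->
  `|(boxavg N f (y + map_mx intr k) - boxavg N f y) -
    (boxavg N f (z + map_mx intr k) - boxavg N f z)| <=
  n%:R * (2 * (L * enorm (y - z)) / N%:R) * enorm (map_mx intr k : 'rV[R]_n).
Proof.
(* The second difference in [y], [z] and [k] is regrouped as a lattice increment of the average of
   [d], which is bounded because [f] is Lipschitz. *)
move=> N0 fL; pose d x := f (x + (y - z)) - f x.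
have dB x : `|d x| <= L * enorm (y - z).
  by have := fL x (x + (y - z)); rewrite /d (addrC x) addrK.
have := lattice_steps (boxavg_shift N0 dB) z k; rewrite -!boxavgB -!boxavg_translate.
have -> : z + map_mx intr k + (y - z) = y + map_mx intr k.
  by rewrite addrAC (addrC z) subrK.
by rewrite (addrC z (y - z)) subrK; congr (`|_| <= _); ring.
Qed.

(* The hypothesis on [boxavg N f] at [y0] is contact from above with a paraboloid in
   the rescaled variable; [xi] is the gradient of a penalty. *)
Lemma boxavg_near_linear N (f : 'rV[R]_n -> R) L (S eps : R) y0 q xi y
    (m : 'rV[int]_n) : (0 < N)%N -> 0 < S -> S ^+ 2 = eps -> N%:R^-1 <= S -> 0 <= L ->
  (forall y z, `|f z - f y| <= L * eps * enorm (z - y)) ->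
  (forall Y, boxavg N f Y <= boxavg N f y0 + eps * dot q (Y - y0) +
    1 / (2 * S) * (eps * enorm (Y - y0)) ^+ 2) ->
  enorm xi <= S -> enorm (y - y0) <= n%:R ->
  eps^-1 * boxavg N f (y + map_mx intr m) <=
  eps^-1 * boxavg N f y + dot (q - xi) (map_mx intr m) +
    (2 * n%:R ^+ 2 * L + 1) * S *
    (enorm (map_mx intr m : 'rV[R]_n) + enorm (map_mx intr m : 'rV[R]_n) ^+ 2).
Proof.
move=> N0 S0 S2 NS L0 flip tz xiS yy0; set K : 'rV[R]_n := map_mx intr m.
have n0 : 0 <= n%:R :> R by [].
have eps0 : 0 < eps by rewrite -S2 exprn_gt0.
have eps'0 : 0 < eps^-1 by rewrite invr_gt0.
have := boxavg_increment y y0 m N0 flip; rewrite -/K ler_norml => /andP[_ inc].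
have := tz (y0 + K); rewrite (addrC y0) addrK (addrC K) => tz'.
have h1 : boxavg N f (y + K) - boxavg N f y <=
    eps * dot q K + 1 / (2 * S) * (eps * enorm K) ^+ 2 +
    n%:R * (2 * (L * eps * enorm (y - y0)) / N%:R) * enorm K by lra.
have h2 : n%:R * (2 * (L * eps * enorm (y - y0)) / N%:R) * enorm K <=
    eps * (2 * n%:R ^+ 2 * L * S * enorm K).
  have := ler_wpM2l (mulr_ge0 L0 n0) (ler_pM (enorm_ge0 _) _ yy0 NS).
  rewrite invr_ge0 ler0n => /(_ isT) h.
  have := ler_wpM2l (mulr_ge0 (ltW eps0) (enorm_ge0 K)) h; lra.
(* Here eps = S^2 enters: in the fast variable, a contact paraboloid of curvature 1 / S has
   curvature of order S. *)
have h3 : 1 / (2 * S) * (eps * enorm K) ^+ 2 = eps * (S / 2 * enorm K ^+ 2).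
  by rewrite -S2; field; rewrite gt_eqF.
have h4 : dot xi K <= S * enorm K.
  by apply: (le_trans (dot_le _ _)); rewrite ler_wpM2r ?enorm_ge0.
set slope := 2 * n%:R ^+ 2 * L + 1.
have h5 : boxavg N f (y + K) <= boxavg N f y +
    eps * (dot (q - xi) K + slope * S * (enorm K + enorm K ^+ 2)).
  rewrite dotDl dotNl.
  have h6 : 0 <= (slope - 1 / 2) * S * enorm K ^+ 2.
    rewrite !mulr_ge0 ?enorm_ge0 ?(ltW S0)//.
    have : 0 <= 2 * n%:R ^+ 2 * L by rewrite !mulr_ge0 ?sqr_ge0.
    by rewrite /slope; lra.
  have : 0 <= eps * ((S * enorm K - dot xi K) + (slope - 1 / 2) * S * enorm K ^+ 2).
    by rewrite mulr_ge0 ?(ltW eps0)// addr_ge0//; lra.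
  rewrite /slope in h6 *; lra.
have := ler_wpM2l (ltW eps'0) h5.
by rewrite mulrDr mulKf ?gt_eqF// addrA.
Qed.

End BoxAverageIncrements.

(** * A partition of unity with controlled variation *)

Section Kernel.
Context {R : realType}.
Implicit Types (a b t h s L C : R).

Definition ramp t : R := if t <= 0 then 0 else if t <= 1 then t else 1.

Definition ramp_int t : R :=
  if t <= 0 then 0 else if t <= 1 then t ^+ 2 / 2 else t - 1 / 2.

Lemma ramp_range t : 0 <= ramp t <= 1.
Proof.
by rewrite /ramp; case: (leP t 0) => t0; case: (leP t 1) => t1; apply/andP; lra.
Qed.

Lemma ramp_mono a b : a <= b -> ramp a <= ramp b.
Proof.
rewrite /ramp => ab.
by case: (leP a 0) => a0; case: (leP b 0) => b0; case: (leP a 1) => a1;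
  case: (leP b 1) => b1; lra.
Qed.

Lemma ramp_lip a b : `|ramp b - ramp a| <= `|b - a|.
Proof.
wlog ab : a b / a <= b => [hw|].
  by have [/hw//|/ltW/hw] := leP a b; rewrite distrC (distrC a).
rewrite !ger0_norm ?subr_ge0 ?ramp_mono// /ramp.
by case: (leP a 0) => a0; case: (leP b 0) => b0; case: (leP a 1) => a1;
  case: (leP b 1) => b1; lra.
Qed.

(** Convexity of [ramp_int], whose derivative is [ramp], through its tangents at [a] and at [b]; no
    order between the two points is assumed. *)
Lemma ramp_intP a b : 0 <= ramp_int b - ramp_int a - (b - a) * ramp a <=
  (b - a) * (ramp b - ramp a).
Proof.
rewrite /ramp_int /ramp; have sq := sqr_ge0 (b - a).
by case: (leP a 0) => a0; case: (leP b 0) => b0; case: (leP a 1) => a1;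
  case: (leP b 1) => b1; apply/andP; split; nra.
Qed.

Variable h : R.
Hypothesis h0 : 0 < h.

(* A C^{1,1} step from 0 to 1 across [0, 2h]. The monotone function [vstep] dominates
   the variation of [dstep], so that sums over a grid telescope whatever its mesh. *)
Definition step t := ramp_int (t / h) - ramp_int (t / h - 1).
Definition dstep t := (ramp (t / h) - ramp (t / h - 1)) / h.
Definition vstep t := (ramp (t / h) + ramp (t / h - 1)) / h.

Lemma step_out0 t : t <= 0 -> step t = 0.
Proof.
move=> t0; have : t / h <= 0 by rewrite ler_pdivrMr// mul0r.
rewrite /step /ramp_int; move: (t / h) => a a0.
by case: (leP a 0) => ?; case: (leP (a - 1) 0) => ?; lra.
Qed.

Lemma step_out1 t : 2 * h <= t -> step t = 1.
Proof.
move=> t0; have : 2 <= t / h by rewrite ler_pdivlMr.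
rewrite /step /ramp_int; move: (t / h) => a a0.
case: (leP a 0) => ?; first by lra.
case: (leP a 1) => ?; first by lra.
case: (leP (a - 1) 0) => ?; first by lra.
case: (leP (a - 1) 1) => ?; last by lra.
have -> : a = 2 by lra.
by field.
Qed.

Lemma dstep_out t : t <= 0 \/ 2 * h <= t -> dstep t = 0.
Proof.
case=> t0.
  have : t / h <= 0 by rewrite ler_pdivrMr// mul0r.
  rewrite /dstep /ramp; move: (t / h) => a a0.
  by case: (leP a 0) => ?; case: (leP (a - 1) 0) => ?; rewrite ?subrr ?mul0r//; lra.
have : 2 <= t / h by rewrite ler_pdivlMr.
rewrite /dstep /ramp; move: (t / h) => a a0.
case: (leP a 0) => ?; first by lra.
case: (leP a 1) => ?; first by lra.
case: (leP (a - 1) 0) => ?; first by lra.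
case: (leP (a - 1) 1) => ?; last by rewrite subrr mul0r.
have -> : a = 2 by lra.
by field; rewrite gt_eqF.
Qed.

Lemma dstep_ge0 t : 0 <= dstep t.
Proof.
by rewrite divr_ge0 ?(ltW h0)// subr_ge0 ramp_mono// gerBl.
Qed.

Lemma vstep_range t : 0 <= vstep t <= 2 / h.
Proof.
have := ramp_range (t / h); have := ramp_range (t / h - 1) => h1 h2.
by rewrite divr_ge0 ?(ltW h0)//= ?ler_pM2r ?invr_gt0//; lra.
Qed.

Lemma dstep_var a b : a <= b -> `|dstep b - dstep a| <= vstep b - vstep a.
Proof.
move=> ab; have hab : a / h <= b / h by rewrite ler_pM2r ?invr_gt0.
have hab1 : a / h - 1 <= b / h - 1 by rewrite lerD2r.
have := ramp_mono hab; have := ramp_mono hab1.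
rewrite /dstep /vstep -!mulrBl normrM (gtr0_norm (_ : 0 < h^-1)) ?invr_gt0//.
by rewrite ler_pM2r ?invr_gt0// ler_norml => h1 h2; lra.
Qed.

Lemma step_der a b :
  `|step b - step a - (b - a) * dstep a| <= (b - a) * (vstep b - vstep a).
Proof.
have := ramp_intP (a / h) (b / h); have := ramp_intP (a / h - 1) (b / h - 1).
rewrite /step /dstep /vstep.
have -> : b / h - 1 - (a / h - 1) = b / h - a / h by ring.
have -> : (b - a) * ((ramp (a / h) - ramp (a / h - 1)) / h) =
   (b / h - a / h) * (ramp (a / h) - ramp (a / h - 1)).
  by field; rewrite gt_eqF.
have -> : (b - a) * ((ramp (b / h) + ramp (b / h - 1)) / h -
     (ramp (a / h) + ramp (a / h - 1)) / h) =
   (b / h - a / h) * ((ramp (b / h) + ramp (b / h - 1)) - (ramp (a / h) + ramp (a / h - 1))).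
  by field; rewrite gt_eqF.
by rewrite ler_norml; lra.
Qed.

Lemma vstep_lip a b : `|vstep b - vstep a| <= 2 / h ^+ 2 * `|b - a|.
Proof.
have := ramp_lip (a / h) (b / h); have := ramp_lip (a / h - 1) (b / h - 1).
have -> : b / h - 1 - (a / h - 1) = (b - a) / h by field; rewrite gt_eqF.
rewrite -mulrBl /vstep -mulrBl !normrM (gtr0_norm (_ : 0 < h^-1)) ?invr_gt0//.
have -> : 2 / h ^+ 2 * `|b - a| = (2 * (`|b - a| / h)) / h.
  by field; rewrite gt_eqF.
move: (`|b - a| / h) => D h1 h2.
rewrite ler_pM2r ?invr_gt0//.
have -> : ramp (b / h) + ramp (b / h - 1) - (ramp (a / h) + ramp (a / h - 1)) =
  (ramp (b / h) - ramp (a / h)) + (ramp (b / h - 1) - ramp (a / h - 1)) by ring.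
by apply: (le_trans (ler_normD _ _)); lra.
Qed.

(** [step] is the integral of the nondecreasing [ramp] over a unit window ending at t / h. If the
    windows overlap, only their non-common parts are compared; otherwise the whole windows are. *)
Lemma step_mono a b : a <= b -> step a <= step b.
Proof.
move=> ab; have hab : a / h <= b / h by rewrite ler_pM2r ?invr_gt0.
rewrite /step; move: (a / h) (b / h) hab => A B AB.
have [AB1|AB1] := leP (B - 1) A.
  have /andP[h1 _] := ramp_intP A B; have /andP[h2 _] := ramp_intP (B - 1) (A - 1).
  have : (B - A) * ramp (B - 1) <= (B - A) * ramp A.
    by rewrite ler_wpM2l ?subr_ge0// ramp_mono.
  lra.
have /andP[h1 _] := ramp_intP (B - 1) B; have /andP[h2 _] := ramp_intP A (A - 1).
have := ramp_mono (ltW AB1); lra.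
Qed.

End Kernel.

Lemma telescope_ord (R : zmodType) (Q : nat) (f : nat -> R) :
  \sum_(j < Q) (f j - f j.+1) = f 0%N - f Q.
Proof.
elim: Q => [|Q ih]; first by rewrite big_ord0 subrr.
by rewrite big_ord_recr /= ih addrA subrK.
Qed.

Lemma summation_by_parts (R : pzRingType) (Q : nat) (f c : nat -> R) :
  f 0%N = 0 -> f Q = 0 ->
  \sum_(j < Q) (f j - f j.+1) * c j = \sum_(j < Q) f j.+1 * (c j.+1 - c j).
Proof.
move=> f0 fQ; apply/eqP; rewrite -subr_eq0 -sumrB; apply/eqP.
transitivity (\sum_(j < Q) (f j * c j - f j.+1 * c j.+1)).
  by apply: eq_bigr => j _; rewrite mulrBl mulrBr opprB addrA subrK.
by rewrite (telescope_ord Q (fun j => f j * c j)) f0 fQ !mul0r subrr.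
Qed.

Section Weights.
Context {R : realType}.
Variables (h s z0 : R) (Q : nat).
Hypotheses (h0 : 0 < h) (s0 : 0 < s).
Implicit Types (t a b L C : R) (j : nat).

Definition node j : R := z0 + s * j%:R.
Definition wgt j t := step h (t - node j) - step h (t - node j.+1).
Definition dwgt j t := dstep h (t - node j) - dstep h (t - node j.+1).

Lemma nodeS j : node j.+1 = node j + s.
Proof. by rewrite /node -natr1 mulrDr mulr1 addrA. Qed.

Lemma node_le t j : t - node j.+1 <= t - node j.
Proof. by rewrite nodeS lerD2l lerN2 lerDl ltW. Qed.

Lemma wgt_ge0 j t : 0 <= wgt j t.
Proof. by rewrite subr_ge0 step_mono// node_le. Qed.

Lemma step_range t : 0 <= step h t <= 1.
Proof.
apply/andP; split.
  have [t0|t0] := leP t 0; first by rewrite step_out0.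
  by have := step_mono h0 (ltW t0); rewrite (step_out0 h0 (lexx 0)).
have [th|th] := leP (2 * h) t; first by rewrite step_out1.
by have := step_mono h0 (ltW th); rewrite (step_out1 h0 (lexx (2 * h))).
Qed.

Lemma wgt_le1 j t : wgt j t <= 1.
Proof.
by have := step_range (t - node j); have := step_range (t - node j.+1); rewrite /wgt; lra.
Qed.

Lemma sum_wgt_le1 t : \sum_(j < Q) wgt j t <= 1.
Proof.
rewrite (telescope_ord Q (fun j => step h (t - node j))).
by have := step_range (t - node 0); have := step_range (t - node Q); lra.
Qed.

Lemma sum_dwgt t : \sum_(j < Q) `|dwgt j t| <= 2 / h.
Proof.
apply: (@le_trans _ _ (\sum_(j < Q) (vstep h (t - node j) - vstep h (t - node j.+1)))).
  by apply: ler_sum => j _; apply: dstep_var => //; exact: node_le.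
rewrite (telescope_ord Q (fun j => vstep h (t - node j))).
by have := vstep_range h0 (t - node 0); have := vstep_range h0 (t - node Q); lra.
Qed.

Lemma wgt_support j t : wgt j t != 0 -> `|t - node j| <= 2 * h + s.
Proof.
apply: contraR; rewrite -ltNge ltr_normr => /orP[|] d.
  have := node_le t j; rewrite /wgt nodeS => nl.
  by rewrite !step_out1 ?subrr//; move: (node j) d nl => N d nl; lra.
have := node_le t j; rewrite /wgt nodeS => nl.
have := h0; have := s0 => s0' h0'.
by rewrite !step_out0 ?subrr//; move: (node j) d nl => N d nl; lra.
Qed.

Lemma wgt_der j a b :
  `|wgt j b - wgt j a - (b - a) * dwgt j a| <= 4 / h ^+ 2 * (b - a) ^+ 2.
Proof.
have main i : `|step h (b - node i) - step h (a - node i) - (b - a) * dstep h (a - node i)|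
    <= 2 / h ^+ 2 * (b - a) ^+ 2.
  have := step_der h0 (a - node i) (b - node i).
  have -> : b - node i - (a - node i) = b - a by ring.
  move=> /le_trans; apply; apply: (le_trans (ler_norm _)); rewrite normrM.
  have := vstep_lip h0 (a - node i) (b - node i).
  have -> : b - node i - (a - node i) = b - a by ring.
  move=> /(ler_wpM2l (normr_ge0 (b - a))) /le_trans; apply.
  by rewrite mulrCA -expr2 real_normK ?num_real.
have := main j; have := main j.+1.
rewrite /wgt /dwgt !ler_norml.
have -> : 4 / h ^+ 2 * (b - a) ^+ 2 = 2 / h ^+ 2 * (b - a) ^+ 2 + 2 / h ^+ 2 * (b - a) ^+ 2.
  by rewrite -mulrDl -mulrDl -natrD.
move: (2 / h ^+ 2 * (b - a) ^+ 2) => K; lra.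
Qed.

Section Covered.
Variable t : R.
Hypotheses (tlo : node 0 + 2 * h <= t) (thi : t <= node Q).

Lemma sum_wgt1 : \sum_(j < Q) wgt j t = 1.
Proof.
rewrite (telescope_ord Q (fun j => step h (t - node j))).
by have := tlo; have := thi => h1 h2; rewrite step_out1 ?step_out0 ?subr0//; lra.
Qed.

(** The bounds on [t] place it where [dstep] vanishes at both end nodes, so summation by parts has
    no boundary terms. *)
Lemma dwgt_by_parts (c : nat -> R) : \sum_(j < Q) dwgt j t * c j =
  \sum_(j < Q) dstep h (t - node j.+1) * (c j.+1 - c j).
Proof.
apply: (@summation_by_parts _ Q (fun j => dstep h (t - node j))).
  by apply: dstep_out => //; right; have := tlo; lra.
by apply: dstep_out => //; left; have := thi; lra.
Qed.

(* If [c] is a semiconvex function sampled along a line and [P] its subgradients,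
   differentiating the average of [c] averages [P], up to an error vanishing with
   the mesh. *)
Lemma dwgt_average (c P : nat -> R) L C : 0 <= C -> s <= h ->
  (forall j, `|P j| <= L) ->
  (forall j, s * P j - C * s ^+ 2 <= c j.+1 - c j) ->
  (forall j, c j.+1 - c j <= s * P j.+1 + C * s ^+ 2) ->
  `|\sum_(j < Q) dwgt j t * c j - \sum_(j < Q) wgt j t * P j| <=
  s * (6 * L / h + 3 * C).
Proof.
move=> C0 sh PL c1 c2.
have L0 : 0 <= L by exact: le_trans (normr_ge0 _) (PL 0%N).
pose th j := dstep h (t - node j.+1).
have th0 j : 0 <= th j by exact: dstep_ge0.
(* [s * th j] is the first-order approximation of [wgt j t]; the errors are dominated by increments
   of [vstep] and telescope, so their sum is small with [s] however many nodes there are. *)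
have var : \sum_(j < Q) `|s * th j - wgt j t| <= s * (2 / h).
  apply: (@le_trans _ _ (\sum_(j < Q) s * (vstep h (t - node j) - vstep h (t - node j.+1)))).
    apply: ler_sum => j _; have := step_der h0 (t - node j.+1) (t - node j).
    have -> : t - node j - (t - node j.+1) = s by rewrite nodeS; ring.
    by rewrite distrC.
  rewrite -mulr_sumr (telescope_ord Q (fun j => vstep h (t - node j))).
  rewrite ler_wpM2l ?(ltW s0)//.
  by have := vstep_range h0 (t - node 0); have := vstep_range h0 (t - node Q); lra.
have sth : \sum_(j < Q) s * th j <= 3.
  have : \sum_(j < Q) s * th j <= \sum_(j < Q) (wgt j t + `|s * th j - wgt j t|).
    apply: ler_sum => j _; have := ler_norm (s * th j - wgt j t); lra.
  rewrite big_split /= sum_wgt1.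
  have : s * (2 / h) <= 2.
    rewrite mulrCA ger_pMr//; rewrite ler_pdivrMr// mul1r//.
  lra.
have e1 : `|\sum_(j < Q) (s * th j - wgt j t) * P j| <= s * (2 / h) * L.
  apply: (le_trans (ler_norm_sum _ _ _)).
  apply: (@le_trans _ _ (\sum_(j < Q) `|s * th j - wgt j t| * L)).
    by apply: ler_sum => j _; rewrite normrM ler_wpM2l.
  by rewrite -mulr_suml ler_wpM2r.
(* Single increments of [P] need not be small. Summation by parts moves the difference back onto the
   weights, so only the bound [L] on [P] is used. *)
have e2 : `|\sum_(j < Q) th j * (P j.+1 - P j)| <= 2 / h * L.
  rewrite -dwgt_by_parts; apply: (le_trans (ler_norm_sum _ _ _)).
  apply: (@le_trans _ _ (\sum_(j < Q) `|dwgt j t| * L)).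
    by apply: ler_sum => j _; rewrite normrM ler_wpM2l.
  by rewrite -mulr_suml ler_wpM2r// sum_dwgt.
have lo : \sum_(j < Q) (s * th j * P j - C * s * (s * th j)) <=
    \sum_(j < Q) th j * (c j.+1 - c j).
  apply: ler_sum => j _; have := ler_wpM2l (th0 j) (c1 j); lra.
have hi : \sum_(j < Q) th j * (c j.+1 - c j) <=
    \sum_(j < Q) (s * th j * P j + s * (th j * (P j.+1 - P j)) + C * s * (s * th j)).
  apply: ler_sum => j _; have := ler_wpM2l (th0 j) (c2 j); lra.
have eP : \sum_(j < Q) (s * th j - wgt j t) * P j =
    \sum_(j < Q) s * th j * P j - \sum_(j < Q) wgt j t * P j.
  by rewrite -sumrB; apply: eq_bigr => j _; rewrite mulrBl.
rewrite dwgt_by_parts -/th.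
move: lo hi; rewrite sumrB !big_split /= -!mulr_sumr => lo hi.
move: e1; rewrite eP; move: e2 sth; rewrite -mulr_sumr.
have : 0 <= s * \sum_(j < Q) th j.
  by rewrite mulr_ge0 ?(ltW s0) ?sumr_ge0.
have Cs : 0 <= C * s by rewrite mulr_ge0 ?(ltW s0).
move: lo hi.
set A := \sum_(j < Q) th j * (c j.+1 - c j).
set B := \sum_(j < Q) s * th j * P j.
set D := \sum_(j < Q) wgt j t * P j.
set E := \sum_(j < Q) th j * (P j.+1 - P j).
set S := s * \sum_(j < Q) th j.
move=> lo hi S0 e2 S3 e1.
have CS := ler_wpM2l Cs S3.
have sE : `|s * E| <= s * (2 / h * L) by rewrite normrM (gtr0_norm s0) ler_wpM2l ?(ltW s0).
have Lh : 0 <= s * (L / h) by rewrite mulr_ge0 ?divr_ge0 ?(ltW s0) ?(ltW h0).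
move: e1 sE; rewrite !ler_norml.
have -> : s * (2 / h) * L = 2 * (s * (L / h)) by field; rewrite gt_eqF.
have -> : s * (2 / h * L) = 2 * (s * (L / h)) by field; rewrite gt_eqF.
have -> : s * (6 * L / h + 3 * C) = 6 * (s * (L / h)) + C * s * 3 by field; rewrite gt_eqF.
move: (s * (L / h)) Lh => X X0; lra.
Qed.

End Covered.
End Weights.

(** * One-sided second-order expansions *)

Section Jets.
Context {R : realType} {n : nat}.
Implicit Types (x y z p q : 'rV[R]_n) (f g u v w : 'rV[R]_n -> R) (c k C : R).
Local Notation e_ i := (delta_mx 0 i : 'rV[R]_n).

Definition jet f x p := exists2 C, 0 <= C & forall y, enorm (y - x) <= 1 ->
  `|f y - f x - dot p (y - x)| <= C * enorm (y - x) ^+ 2.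

Definition local_lip f x := exists2 L, 0 <= L &
  forall y, enorm (y - x) <= 1 -> `|f y - f x| <= L * enorm (y - x).

(** A local form of [semiconvex_at] with an unspecified constant, stable under products with smooth
    weights and still sufficient to touch a supersolution. *)
Definition lower_jet f x p := exists2 C, 0 <= C & forall y, enorm (y - x) <= 1 ->
  f x + dot p (y - x) - C * enorm (y - x) ^+ 2 <= f y.

Lemma min_lower_jet v w x q y0 k :
  (forall y, v x - w x + k * enorm (x - y0) ^+ 2 <=
             v y - w y + k * enorm (y - y0) ^+ 2) ->
  lower_jet w x q -> exists c, touch_below v x (q - (2 * k) *: (x - y0)) c.
Proof.
move=> h [c c0 sw]; exists (c + k).
apply: (@filterS _ _ (nbhs_filter x) _ _ _ (enorm_nbhs x ltr01)) => y yx.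
have := h y; have := sw y (ltW yx).
have := enorm_sqD (y - x) (x - y0); rewrite addrA subrK => ->.
by rewrite [dot (q - _) _]dotDl dotNl dotZl (dotC (x - y0)); lra.
Qed.

Lemma semiconvex_lower_jet w x q c : 0 <= c -> semiconvex_at w x q c ->
  lower_jet w x q.
Proof. by move=> c0 h; exists c => // y _; exact: h. Qed.

Lemma dot_delta a (i : 'I_n) x : dot (a *: e_ i) x = a * x 0 i.
Proof.
rewrite dotZl /dot (bigD1 i)//= big1 ?addr0 => [|j /negPf ji].
  by rewrite mxE !eqxx mul1r.
by rewrite mxE eqxx ji mul0r.
Qed.

Lemma jet_coord (f : R -> R) df K (i : 'I_n) x : 0 <= K ->
  (forall b, `|f b - f (x 0 i) - (b - x 0 i) * df| <= K * (b - x 0 i) ^+ 2) ->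
  jet (fun y => f (y 0 i)) x (df *: e_ i).
Proof.
move=> K0 h; exists K => // y _; rewrite dot_delta !mxE mulrC.
apply: (le_trans (h _)); rewrite ler_wpM2l//.
have := enorm_coord (y - x) i; rewrite !mxE => le.
by rewrite -[leLHS]real_normK ?num_real// (@ler_pXn2r _ 2) ?nnegrE ?enorm_ge0.
Qed.

Lemma jet_lip f x p : jet f x p -> local_lip f x.
Proof.
move=> [C C0 hf]; exists (enorm p + C); first by rewrite addr_ge0 ?enorm_ge0.
move=> y y1; have := hf y y1; have := dot_norm p (y - x).
have : C * enorm (y - x) ^+ 2 <= C * enorm (y - x).
  by rewrite ler_wpM2l// expr2 ler_piMl// enorm_ge0.
move: (f y - f x) (dot p (y - x)) => F D h1 h2 h3.
have := ler_normD (F - D) D; rewrite subrK mulrDl; lra.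
Qed.

Lemma jetM f g x p q : jet f x p -> jet g x q ->
  jet (fun y => f y * g y) x (g x *: p + f x *: q).
Proof.
move=> jf jg; have [L L0 hL] := jet_lip jf; have [M M0 hM] := jet_lip jg.
have [A A0 hA] := jf; have [B B0 hB] := jg.
exists (`|f x| * B + `|g x| * A + L * M) => [|y y1].
  by rewrite !addr_ge0 ?mulr_ge0.
rewrite dotDl !dotZl.
have -> : f y * g y - f x * g x - (g x * dot p (y - x) + f x * dot q (y - x)) =
  f x * (g y - g x - dot q (y - x)) + g x * (f y - f x - dot p (y - x)) +
  (f y - f x) * (g y - g x) by ring.
set N := enorm (y - x) ^+ 2; have := ler_wpM2l (normr_ge0 (f x)) (hB y y1).
have := ler_wpM2l (normr_ge0 (g x)) (hA y y1).
have := ler_pM (normr_ge0 _) (normr_ge0 _) (hL y y1) (hM y y1).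
rewrite -!normrM mulrACA -expr2 -/N => h1 h2 h3.
apply: (le_trans (ler_normD _ _)); apply: (le_trans (lerD (ler_normD _ _) h1)).
by move: h2 h3; lra.
Qed.

Lemma jet_prod (r : seq 'I_n) (f df : 'I_n -> R -> R) K x : uniq r -> 0 <= K ->
  (forall i b, `|f i b - f i (x 0 i) - (b - x 0 i) * df i (x 0 i)| <=
     K * (b - x 0 i) ^+ 2) ->
  jet (fun y => \prod_(i <- r) f i (y 0 i)) x
    (\row_l if l \in r then df l (x 0 l) * \prod_(i <- r | i != l) f i (x 0 i) else 0).
Proof.
move=> + K0 hf; elim: r => [_|i r ih /= /andP[ir ur]].
  exists 0 => // y _; rewrite !big_nil subrr mul0r sub0r normrN /dot big1 ?normr0//.
  by move=> l _; rewrite mxE mul0r.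
under eq_fun do rewrite big_cons.
have := jetM (jet_coord K0 (hf i)) (ih ur).
congr (jet _ _ _); apply/rowP => l; rewrite !mxE in_cons.
rewrite big_cons (eq_sym i l); case: (eqVneq l i) => [->|li] /=.
  rewrite (negPf ir) mulr0 addr0 mulr1 mulrC; congr (_ * _).
  rewrite [RHS]big_seq_cond [LHS]big_seq; apply: eq_bigl => j.
  by case: (boolP (j \in r)) => //= jr; apply/esym; apply: contraNneq ir => <-.
by rewrite mulr0 mulr0 add0r; case: (l \in r); rewrite ?mulr0// mulrCA.
Qed.

Lemma lower_jetD f g x p q : lower_jet f x p -> lower_jet g x q ->
  lower_jet (f \+ g) x (p + q).
Proof.
move=> [A A0 hA] [B B0 hB]; exists (A + B); first exact: addr_ge0.
by move=> y y1; have := hA y y1; have := hB y y1; rewrite dotDl /=; lra.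
Qed.

Lemma lower_jet_sum (I : finType) (f : I -> 'rV[R]_n -> R) x (p : I -> 'rV[R]_n) :
  (forall i, lower_jet (f i) x (p i)) ->
  lower_jet (fun y => \sum_i f i y) x (\sum_i p i).
Proof.
move=> h; elim: (index_enum I) => [|i r ih].
  under eq_fun do rewrite big_nil.
  by exists 0 => // y _; rewrite big_nil dotC dot0r mul0r; lra.
rewrite big_cons; under eq_fun do rewrite big_cons.
exact: lower_jetD.
Qed.

(** A one-sided expansion of [g] survives multiplication only by a nonnegative factor. The cross
    term of the variation of [f] with the slope of [g] is quadratic, hence part of the remainder. *)
Lemma lower_jetM f g x p q : (forall y, 0 <= f y <= 1) ->
  jet f x p -> lower_jet g x q ->
  lower_jet (fun y => f y * g y) x (f x *: q + g x *: p).
Proof.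
move=> f01 jf [B B0 hB]; have [L L0 hL] := jet_lip jf; have [A A0 hA] := jf.
exists (`|g x| * A + L * enorm q + B); first by rewrite !addr_ge0 ?mulr_ge0 ?enorm_ge0.
move=> y y1; have /andP[f0 f1] := f01 y.
have := ler_wpM2l f0 (hB y y1); apply: le_trans.
rewrite dotDl !dotZl.
set d := dot q (y - x); set e := dot p (y - x); set N := enorm (y - x) ^+ 2.
have N0 : 0 <= N by rewrite sqr_ge0.
have h1 : - (`|g x| * A * N) <= g x * (f y - f x - e).
  rewrite lerNl -mulrN; apply: (le_trans (ler_norm _)).
  by rewrite normrM normrN -mulrA ler_wpM2l// hA.
have h2 : - (L * enorm q * N) <= (f y - f x) * d.
  rewrite lerNl -mulNr; apply: (le_trans (ler_norm _)).
  rewrite normrM normrN /N expr2 mulrACA ler_pM ?hL//; exact: dot_norm.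
have h3 : f y * (B * N) <= B * N by rewrite ler_piMl// mulr_ge0.
lra.
Qed.

Lemma local_lip_continuous f : (forall x, local_lip f x) -> continuous f.
Proof.
move=> h; apply: continuous_enorm => x e e0; have [L L0 hL] := h x.
have L1 : 0 < L + 1 by rewrite ltr_wpDl.
exists (Num.min 1 (e / (L + 1))) => [|y]; first by rewrite lt_min ltr01 divr_gt0.
rewrite lt_min ltr_pdivlMr// => /andP[/ltW y1 ye].
apply: (le_lt_trans (hL y y1)); apply: le_lt_trans ye.
by rewrite mulrC ler_wpM2l ?enorm_ge0// lerDl.
Qed.

Lemma local_lipM f g x : local_lip f x -> local_lip g x ->
  local_lip (fun y => f y * g y) x.
Proof.
move=> [A A0 hA] [B B0 hB]; exists (A * (`|g x| + B) + `|f x| * B).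
  by rewrite addr_ge0 ?mulr_ge0 ?addr_ge0.
move=> y y1; have := hA y y1; have := hB y y1 => h1 h2.
have -> : f y * g y - f x * g x = (f y - f x) * g y + f x * (g y - g x) by ring.
apply: (le_trans (ler_normD _ _)); rewrite !normrM mulrDl.
have D0 := enorm_ge0 (y - x).
have gy : `|g y| <= `|g x| + B.
  have := ler_normD (g x) (g y - g x); rewrite addrC subrK => /le_trans; apply.
  by rewrite lerD2l; apply: (le_trans h1); rewrite ler_piMr.
have := ler_pM (normr_ge0 _) (normr_ge0 _) h2 gy.
have := ler_wpM2l (normr_ge0 (f x)) h1; lra.
Qed.

Lemma local_lip_sum (I : finType) (f : I -> 'rV[R]_n -> R) x :
  (forall i, local_lip (f i) x) -> local_lip (fun y => \sum_i f i y) x.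
Proof.
move=> h; elim: (index_enum I) => [|i r [A A0 hA]].
  by exists 0 => // y _; rewrite !big_nil subrr normr0 mul0r.
have [B B0 hB] := h i; exists (B + A); first exact: addr_ge0.
move=> y y1; rewrite !big_cons opprD addrACA mulrDl.
by apply: (le_trans (ler_normD _ _)); rewrite lerD ?hA ?hB.
Qed.

End Jets.

(** * Tensor-product weights on a grid and their gradients *)

Section ProductKernel.
Context {R : realType} {n : nat}.
Implicit Types (x y z p q : 'rV[R]_n) (c C L : R).
Variables (h s z0 : R) (Q : nat).
Hypotheses (h0 : 0 < h) (s0 : 0 < s).
Local Notation e_ i := (delta_mx 0 i : 'rV[R]_n).
Local Notation idx := {ffun 'I_n -> 'I_Q}.

Definition gridpt (k : idx) : 'rV[R]_n := \row_i node s z0 (k i).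
Definition wgts x (i : 'I_n) (j : 'I_Q) : R := wgt h s z0 j (x 0 i).
Definition wgtn (k : idx) x : R := prodw (wgts x) k.
Definition dwgtn (k : idx) x : 'rV[R]_n := \row_i
  (dwgt h s z0 (k i) (x 0 i) * \prod_(l | l != i) wgts x l (k l)).

Lemma wgts_ge0 x i j : 0 <= wgts x i j. Proof. exact: wgt_ge0. Qed.

Lemma wgtn_ge0 k x : 0 <= wgtn k x.
Proof. exact: prodw_ge0 (wgts_ge0 x). Qed.

Lemma wgtn_range k x : 0 <= wgtn k x <= 1.
Proof. by rewrite wgtn_ge0 prodr_ile1// => i _; rewrite wgts_ge0 wgt_le1. Qed.

Lemma sum_wgtn_le1 x : \sum_k wgtn k x <= 1.
Proof.
rewrite sum_prodw prodr_ile1// => i _; rewrite sum_wgt_le1// andbT.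
by apply: sumr_ge0 => j _; exact: wgts_ge0.
Qed.

Lemma wgtn_support k x : wgtn k x != 0 -> enorm (x - gridpt k) <= n%:R * (2 * h + s).
Proof.
move=> /prodf_neq0 w; apply: enorm_le_coord => i; rewrite !mxE.
by apply: wgt_support => //; exact: w.
Qed.

Lemma jet_wgtn k x : jet (wgtn k) x (dwgtn k x).
Proof.
have K0 : 0 <= 4 / h ^+ 2 by rewrite divr_ge0 ?sqr_ge0.
have := @jet_prod R n (index_enum 'I_n) (fun i => wgt h s z0 (k i))
  (fun i => dwgt h s z0 (k i)) _ x (index_enum_uniq _) K0
  (fun i b => wgt_der s z0 h0 (k i) (x 0 i) b).
congr (jet _ _ _); apply/rowP => i; rewrite !mxE mem_index_enum.
by [].
Qed.

Section Covered.
Variable x : 'rV[R]_n.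
Hypothesis xin : forall i, node s z0 0 + 2 * h <= x 0 i <= node s z0 Q.

Lemma wgts_sum i : \sum_j wgts x i j = 1.
Proof. by have /andP[lo hi] := xin i; exact: sum_wgt1. Qed.

Lemma sum_wgtn1 : \sum_k wgtn k x = 1.
Proof. exact: sum_prodw1 wgts_sum. Qed.

Lemma sum_dwgtn (G : idx -> R) i : \sum_k dwgtn k x 0 i * G k =
  \sum_k wgtn k x * \sum_(j < Q) dwgt h s z0 j (x 0 i) * G (upd k i j).
Proof.
rewrite -(sum_coordinate (fun j : 'I_Q => dwgt h s z0 j (x 0 i)) G (wgts_sum i)).
by apply: eq_bigr => k _; rewrite mxE.
Qed.

(** Differentiation in direction [i] sees only the one-dimensional weights of that direction, so the
    bound depends neither on the mesh nor on the number of nodes. *)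
Lemma sum_dwgtn_bound (G : idx -> R) B i : (forall k, `|G k| <= B) ->
  `|\sum_k dwgtn k x 0 i * G k| <= 2 / h * B.
Proof.
move=> GB; rewrite sum_dwgtn; apply: (le_trans (ler_norm_sum _ _ _)).
set D := 2 / h * B; rewrite -[leRHS]mul1r -sum_wgtn1 mulr_suml.
apply: ler_sum => k _; rewrite normrM (ger0_norm (wgtn_ge0 _ _)).
rewrite ler_wpM2l ?wgtn_ge0//; apply: (le_trans (ler_norm_sum _ _ _)).
have B0 : 0 <= B by exact: le_trans (normr_ge0 _) (GB k).
apply: (@le_trans _ _ (\sum_(j < Q) `|dwgt h s z0 j (x 0 i)| * B)).
  by apply: ler_sum => j _; rewrite normrM ler_wpM2l.
by rewrite -mulr_suml ler_wpM2r// sum_dwgt.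
Qed.

(** Resampling coordinate [i] reduces the claim to [dwgt_average] on each grid line parallel to that
    axis. The subgradients at two neighbouring nodes bound the increment of [w] from both sides. *)
Lemma dwgtn_average (w : 'rV[R]_n -> R) (p : 'rV[R]_n -> 'rV[R]_n) L C i :
  0 <= C -> s <= h -> (forall y, enorm (p y) <= L) ->
  (forall y, semiconvex_at w y (p y) C) ->
  `|\sum_k dwgtn k x 0 i * w (gridpt k) - \sum_k wgtn k x * p (gridpt k) 0 i|
    <= s * (6 * L / h + 3 * C).
Proof.
move=> C0 sh pL wC.
have -> : \sum_k wgtn k x * p (gridpt k) 0 i =
    \sum_k wgtn k x * \sum_j wgts x i j * p (gridpt (upd k i j)) 0 i.
  rewrite -(sum_coordinate (wgts x i) (fun k => p (gridpt k) 0 i) (wgts_sum i)).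
  by apply: eq_bigr => k _; rewrite /wgtn /prodw (bigD1 i).
rewrite sum_dwgtn -sumrB; set D := s * _.
apply: (le_trans (ler_norm_sum _ _ _)).
rewrite -[leRHS]mul1r -sum_wgtn1 mulr_suml.
apply: ler_sum => k _; rewrite -mulrBr normrM (ger0_norm (wgtn_ge0 _ _)).
rewrite ler_wpM2l ?wgtn_ge0//.
pose b := gridpt k - node s z0 (k i) *: e_ i.
have bE j : gridpt (upd k i j) = b + node s z0 j *: e_ i.
  apply/rowP => l; rewrite !mxE ffunE eqxx /=; case: eqVneq => [->|li].
    by rewrite !mulr1 subrr add0r.
  by rewrite !mulr0 subr0 addr0.
have /andP[lo hi] := xin i.
have step (j : nat) : b + node s z0 j.+1 *: e_ i = b + node s z0 j *: e_ i + s *: e_ i.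
  by rewrite nodeS scalerDl addrA.
have se : enorm (s *: e_ i) ^+ 2 = s ^+ 2.
  rewrite -dotxx dotZl dotC dot_delta mxE !eqxx mulr1; ring.
have := @dwgt_average R h s z0 Q h0 s0 (x 0 i) lo hi
  (fun j => w (b + node s z0 j *: e_ i)) (fun j => p (b + node s z0 j *: e_ i) 0 i)
  L C C0 sh => av.
under eq_bigr do rewrite bE.
under [X in _ - X]eq_bigr do rewrite bE.
apply: av.
- by move=> j; apply: le_trans (enorm_coord _ _) (pL _).
- move=> j; have := wC (b + node s z0 j *: e_ i) (b + node s z0 j.+1 *: e_ i).
  rewrite step [_ + s *: _ - _]addrC addrA addNr add0r se dotC dot_delta; lra.
move=> j; have := wC (b + node s z0 j.+1 *: e_ i) (b + node s z0 j *: e_ i).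
have -> : b + node s z0 j *: e_ i - (b + node s z0 j.+1 *: e_ i) = - (s *: e_ i).
  by rewrite step opprD addrA subrr sub0r.
by rewrite enormN se dotNr dotC dot_delta; lra.
Qed.

End Covered.
End ProductKernel.

(** * Comparison and correctors *)

Section Approximation.
Context {R : realType} {n : nat}.
Implicit Types (x y z p q : 'rV[R]_n) (u v w : 'rV[R]_n -> R) (k M : R).

(** [P] stands for the viscosity inequality at the touching point. Since q = 2 k (z - y), a gradient
    bound implied by [P] is also a bound on the displacement of [z] from [y]. *)
Lemma supconv_approx u M k rho (P : 'rV[R]_n -> 'rV[R]_n -> Prop) :
  continuous u -> (forall x, `|u x| <= M) -> 0 < k ->
  (forall z q c, touch_above u z q c -> P z q) ->
  (forall z q, P z q -> enorm q <= rho) ->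
  exists w, [/\ is_supconv k u w, forall x, `|w x| <= M &
    forall y, exists z q, [/\ P z q, enorm (z - y) <= rho / (2 * k),
      semiconvex_at w y q k, u y <= w y & w y <= u z]].
Proof.
move=> cu uM k0 uP Prho; have [w sw] := supconv_exists cu uM k0.
exists w; split=> // [|y]; first exact: supconv_bounded k0 sw uM.
have [z [q [qE tz sc uw wu]]] := supconv_jet y k0 sw.
have Pzq : P z q by apply: (uP z q k); exact: touch_aboveW.
exists z, q; split=> //; have := Prho _ _ Pzq.
rewrite qE enormZ gtr0_norm ?mulr_gt0// => h.
by rewrite ler_pdivlMr ?mulr_gt0// mulrC.
Qed.

(* The penalty is centred at [x0], so that it does not enter the final estimate at
   [x0]; its gradient is made small by the choice of its weight. *)
Lemma compare_at (v w : 'rV[R]_n -> R) M x0 (e : R) : continuous v -> continuous w ->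
  (forall x, `|v x| <= M) -> (forall x, `|w x| <= M) -> 0 < e ->
  exists k x, [/\ 0 < k, enorm ((2 * k) *: (x - x0)) <= e,
    enorm (x - x0) <= (16 * M + 1) / e,
    v x - w x <= v x0 - w x0 &
    forall y, v x - w x + k * enorm (x - x0) ^+ 2 <=
              v y - w y + k * enorm (y - x0) ^+ 2].
Proof.
move=> cv cw vM wM e0; have M0 : 0 <= M by exact: le_trans (normr_ge0 _) (vM 0).
have Mp : 0 < 16 * M + 1 by lra.
(* At the minimiser k |x - x0|^2 <= 4 M, so the squared gradient of the penalty is at most 16 k M,
   which this choice keeps below e^2; the 1 covers M = 0. *)
have [k k0 kE] : exists2 k, 0 < k & k = e ^+ 2 / (16 * M + 1).
  by exists (e ^+ 2 / (16 * M + 1)); rewrite ?divr_gt0 ?exprn_gt0.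
have cvw : continuous (fun x => v x - w x).
  by apply: continuous_add => //; under eq_fun do rewrite -mulN1r; exact: continuous_scale.
have vwM x : `|v x - w x| <= 2 * M.
  apply: (le_trans (ler_normB _ _)); have := vM x; have := wM x; lra.
have [x hx] := min_penalized x0 cvw vwM k0.
have hx0 := hx x0; rewrite subrr enorm0 expr0n mulr0 addr0 in hx0.
have kx : k * enorm (x - x0) ^+ 2 <= 4 * M.
  by have := vwM x; have := vwM x0; rewrite !ler_norml; lra.
exists k, x; split=> //; last first.
- by apply: le_trans hx0; rewrite lerDl mulr_ge0 ?sqr_ge0// ltW.
- rewrite -(@ler_pXn2r _ 2) ?nnegrE ?divr_ge0 ?enorm_ge0 ?(ltW Mp) ?(ltW e0)//.
  rewrite -(ler_pM2l k0); apply: (le_trans kx).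
  have -> : k * ((16 * M + 1) / e) ^+ 2 = 16 * M + 1.
    by rewrite kE; field; rewrite !gt_eqF.
  by lra.
rewrite enormZ gtr0_norm ?mulr_gt0//.
rewrite -(@ler_pXn2r _ 2) ?nnegrE ?mulr_ge0 ?enorm_ge0 ?(ltW k0) ?(ltW e0)//.
have -> : (2 * k * enorm (x - x0)) ^+ 2 = 4 * k * (k * enorm (x - x0) ^+ 2) by ring.
apply: (@le_trans _ _ (4 * k * (4 * M))); first by rewrite ler_wpM2l// mulr_ge0// ltW.
have -> : 4 * k * (4 * M) = e ^+ 2 * (16 * M / (16 * M + 1)).
  by rewrite kE; field; rewrite gt_eqF.
by rewrite ler_piMr ?sqr_ge0// ler_pdivrMr// mul1r; lra.
Qed.

(** Comparison with the zero function: at the penalised minimum the test gradient is at most 1 / 2,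
    where [G] is bounded by [B]. The crude bound [M] on [u] does not survive in the conclusion. *)
Lemma super_lower_bound (G : 'rV[R]_n -> 'rV[R]_n -> R) lam u M B : 0 < lam ->
  continuous u -> (forall x, `|u x| <= M) ->
  viscosity_supersolution (fun x r p => lam * r + G x p) u ->
  (forall x p, enorm p < 1 -> G x p <= B) -> forall x, - B <= lam * u x.
Proof.
move=> lam0 cu uM su GB x0; have M0 : 0 <= M by exact: le_trans (normr_ge0 _) (uM 0).
have [|||||k [x [k0 g1 _ ux hx]]] := @compare_at u (fun=> 0) M x0 (1 / 2) => //.
- exact: cst_continuous.
- by move=> x; rewrite normr0.
have := @semiconvex_lower_jet R n (fun=> 0) x 0 0 (lexx _).
have sc0 : semiconvex_at (fun=> 0) x 0 0.
  by move=> z; rewrite dotC dot0r mul0r subr0 addr0.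
move=> /(_ sc0) /(min_lower_jet hx)[c /(super_touch su)].
rewrite sub0r => h; have := GB x (- ((2 * k) *: (x - x0))).
rewrite enormN => /(_ (le_lt_trans g1 _)) GBx.
have : G x (- ((2 * k) *: (x - x0))) <= B by apply: GBx; lra.
have : lam * u x <= lam * u x0 by rewrite ler_wpM2l ?(ltW lam0)//; lra.
lra.
Qed.

End Approximation.

(** * Modulus of continuity on the gradient ball and regularised correctors *)

Section Assembly.
Context {R : realType} {n : nat}.
Variables (H : 'rV[R]_n -> 'rV[R]_n -> 'rV[R]_n -> R) (M0 R0 : R).
Hypotheses (H1 : hypH1 H) (R0_ge0 : 0 <= R0)
  (HR0 : forall x y p, H x y p <= M0 -> enorm p <= R0).
Implicit Types (x y z p q : 'rV[R]_n) (e d : R).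

Lemma H_modulus e : 0 < e -> exists2 d, 0 < d & forall x1 x2 y1 y2 p,
  enorm p <= R0 -> enorm (x1 - x2) < d -> enorm (y1 - y2) < d ->
  H x1 y1 p <= H x2 y2 p + e.
Proof.
move=> e0; have [|_ /(_ e e0)[d d0 hd]] := H1 (r := R0 + 1).
  by rewrite ltr_wpDl.
exists d => // x1 x2 y1 y2 p pR xx yy.
have pR1 : enorm p < R0 + 1 by apply: le_lt_trans pR _; rewrite ltrDl.
have := hd x1 x2 y1 y2 p p pR1 pR1 xx yy; rewrite subrr enorm0 => /(_ d0).
rewrite ltr_norml => /andP[_]; lra.
Qed.

(** The condition [b <= M0] puts the total gradient [p + q] in the ball of radius [R0]. The
    resulting Lipschitz bound, with periodicity, controls the oscillation of the corrector uniformly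
    in [x] and [p]. *)
Lemma corrector_approx e : 0 < e -> exists2 k, 0 < k &
  forall x p b, enorm p <= R0 -> b <= M0 -> cell_problem_solvable H x p b ->
  exists phi : 'rV[R]_n -> R, (forall y, `|phi y| <= 2 * R0 * n%:R) /\
    forall y, exists q, [/\ H x y (p + q) <= b + e, enorm (p + q) <= R0, enorm q <= 2 * R0 &
      semiconvex_at phi y q k].
Proof.
move=> e0; have [d d0 hd] := H_modulus e0.
(* With [R0 + 1] in place of [R0] the displacement d R0 / (R0 + 1) is strictly below the modulus
   [d], also when R0 = 0. *)
have k0 : 0 < (R0 + 1) / d by rewrite divr_gt0// ltr_wpDl.
exists ((R0 + 1) / d) => // x p b pR bM [v [pv [cv sv _]]].
have [M vM] := periodic_bounded cv pv.
have [z q c tz|z q hz|w [sw _ hw]] := @supconv_approx R n v M ((R0 + 1) / d) (2 * R0)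
    (fun z q => H x z (p + q) <= b /\ enorm (p + q) <= R0) cv vM k0.
- have := sub_touch sv tz; rewrite subr_le0 => hb; split=> //.
  by apply: (HR0 (x := x) (y := z)); exact: le_trans hb bM.
- have -> : q = (p + q) - p by rewrite addrC addKr.
  by apply: (le_trans (enormD _ _)); rewrite enormN; case: hz; lra.
have wlip : forall y y', `|w y' - w y| <= 2 * R0 * enorm (y' - y).
  apply: (semiconvex_lipschitz (k := (R0 + 1) / d)) => y.
  have [z [q [[_ pq] _ sc _ _]]] := hw y; exists q => //.
  have -> : q = (p + q) - p by rewrite addrC addKr.
  by apply: (le_trans (enormD _ _)); rewrite enormN; lra.
exists (fun y => w y - w 0); split=> y.
  have [m hm] := lattice_reduction y 0.
  rewrite -(subrK (map_mx intr m) y) (supconv_periodic sw pv).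
  apply: (le_trans (wlip _ _)); rewrite ler_wpM2l ?mulr_ge0//.
have [z [q [[hz pq] zy sc _ _]]] := hw y; exists q; split.
- apply: (le_trans (hd x x y z (p + q) pq _ _)); rewrite ?subrr ?enorm0//; last lra.
  rewrite enormB; apply: (le_lt_trans zy).
  have -> : 2 * R0 / (2 * ((R0 + 1) / d)) = d * (R0 / (R0 + 1)).
    by field; rewrite !gt_eqF// ltr_wpDl.
  by rewrite gtr_pMr// ltr_pdivrMr ?mul1r ?ltrDl// ltr_wpDl.
- exact: pq.
- have -> : q = (p + q) - p by rewrite addrC addKr.
  by apply: (le_trans (enormD _ _)); rewrite enormN; lra.
by move=> y'; have := sc y'; lra.
Qed.

End Assembly.

(** * Upper bound *)

Lemma sqrt_scale (R : realType) (eps : R) : 0 < eps < 1 ->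
  exists (S : R) N, [/\ 0 < S, S < 1, S ^+ 2 = eps,
  S = Num.sqrt eps & [/\ (0 < N)%N, N%:R^-1 <= S & eps * N%:R <= 2 * S]].
Proof.
move=> /andP[eps0 eps1]; set S := Num.sqrt eps.
have S0 : 0 < S by rewrite sqrtr_gt0.
have S2 : S ^+ 2 = eps by rewrite sqr_sqrtr// ltW.
have S1 : S < 1 by rewrite -(@ltr_pXn2r _ 2) ?nnegrE ?(ltW S0)// S2 expr1n.
(* Rounding 1 / S up makes N positive and 1 / N <= S, while eps N <= S + S^2 <= 2 S. *)
exists S, (Num.truncn S^-1).+1; split=> //; split=> //.
  rewrite -[leRHS]invrK lef_pV2 ?posrE ?invr_gt0//; exact/ltW/truncnS_gt.
have : (Num.truncn S^-1)%:R <= S^-1 by rewrite truncn_le// invr_ge0 ltW.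
rewrite -natr1 -S2 => h.
have : S ^+ 2 * (Num.truncn S^-1)%:R <= S ^+ 2 * S^-1 by rewrite ler_wpM2l ?sqr_ge0.
have -> : S ^+ 2 * S^-1 = S by field; rewrite gt_eqF.
have : S ^+ 2 <= S by rewrite expr2 ler_piMl// ltW.
lra.
Qed.


Section OscillatingRegularisation.
Context {R : realType} {n : nat}.
Variables (H : 'rV[R]_n -> 'rV[R]_n -> 'rV[R]_n -> R) (M0 R0 : R).
Hypotheses (H1 : hypH1 H) (R0_ge0 : 0 <= R0)
  (HM0 : forall x y p, enorm p < 1 -> H x y p <= M0)
  (HR0 : forall x y p, H x y p <= M0 -> enorm p <= R0).
Implicit Types (x y z p q : 'rV[R]_n).

(* The scale of the sup-convolution depends on [eps] through the modulus of
   continuity of [H], but nothing below is quantitative in that scale. *)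
Lemma ueps_regular lam eps e ueps : 0 < lam -> 0 < eps < 1 -> 0 < e -> BUC ueps ->
  viscosity_solution (fun x r p => lam * r + H x (eps^-1 *: x) p) ueps ->
  exists k w, [/\ 0 < k, exists M, forall x, `|w x| <= M, forall y, ueps y <= w y &
    forall y, exists q, [/\ lam * w y + H y (eps^-1 *: y) q <= e, enorm q <= R0 &
      semiconvex_at w y q k]].
Proof.
move=> lam0 /andP[eps0 eps1] e0 [[M uM] _] [cu subu supu].
have [d d0 hd] := H_modulus H1 R0_ge0 e0.
have lb : forall x, - M0 <= lam * ueps x.
  apply: (super_lower_bound (G := fun x p => H x (eps^-1 *: x) p) lam0 cu uM supu).
  by move=> x p; exact: HM0.
have R1 : 0 < R0 + 1 by rewrite ltr_wpDl.
have de : 0 < d * eps by rewrite mulr_gt0.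
have k0 : 0 < (R0 + 1) / (d * eps) by rewrite divr_gt0.
have [z q c tz|z q hz|w [_ wM hw]] := @supconv_approx R n ueps M _ R0
    (fun z q => lam * ueps z + H z (eps^-1 *: z) q <= 0) cu uM k0.
- exact: (sub_touch subu tz).
- by apply: (HR0 (x := z) (y := eps^-1 *: z)); have := lb z; lra.
exists ((R0 + 1) / (d * eps)), w; split=> //; first by exists M.
  by move=> y; have [z [q []]] := hw y.
move=> y; have [z [q [hz zy sc _ wu]]] := hw y.
have qR : enorm q <= R0.
  by apply: (HR0 (x := z) (y := eps^-1 *: z)); have := lb z; lra.
exists q; split=> //.
have zyd : enorm (y - z) < d * eps.
  rewrite enormB; apply: (le_lt_trans zy).
  have -> : R0 / (2 * ((R0 + 1) / (d * eps))) = d * eps * (R0 / (2 * (R0 + 1))).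
    by field; rewrite !gt_eqF.
  by rewrite gtr_pMr// ltr_pdivrMr ?mulr_gt0// mul1r; lra.
have wz : lam * w y <= lam * ueps z by rewrite ler_wpM2l// ltW.
have := hd y z (eps^-1 *: y) (eps^-1 *: z) q qR.
rewrite -scalerBr enormZ gtr0_norm ?invr_gt0// => hyz.
suff : H y (eps^-1 *: y) q <= H z (eps^-1 *: z) q + e by lra.
apply: hyz; last by rewrite mulrC ltr_pdivrMr.
by apply: (lt_trans zyd); rewrite gtr_pMr.
Qed.

End OscillatingRegularisation.

(** [E] leaves room for the error gradient returned by [cell_compare], of size at most 4 a (5 n + 1)
    with a = (2 n^2 R0 + 1) S and S < 1, so that [H] is Lipschitz in p, with constant [Lam], at all
    gradients met. *)
Lemma upper_bound (R : realType) (n : nat)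
    (H : 'rV[R]_n -> 'rV[R]_n -> 'rV[R]_n -> R) (M0 R0 E Lam LH : R)
    (Hbar : 'rV[R]_n -> 'rV[R]_n -> R)
    (Hper : forall x p, Zperiodic (fun y => H x y p))
    (H1 : hypH1 H) (R0_ge0 : 0 <= R0)
    (HM0 : forall x y p, enorm p < 1 -> H x y p <= M0)
    (HR0 : forall x y p, H x y p <= M0 -> enorm p <= R0)
    (H3 : hypH3 H) (LH0 : 0 <= LH)
    (HLH : forall x1 x2 y p, H x1 y p <= H x2 y p + LH * enorm (x1 - x2))
    (Lam0 : 0 <= Lam)
    (HLam : forall x y p q, enorm p <= R0 + E -> enorm q <= R0 + E ->
       H x y p - H x y q <= Lam * enorm (p - q))
    (HbarP : forall x p, cell_problem_solvable H x p (Hbar x p))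
    (HE : 4 * (2 * n%:R ^+ 2 * R0 + 1) * (5 * n%:R + 1) <= E) :
  exists2 C, 0 <= C & forall (lam eps : R), 0 < lam < 1 -> 0 < eps < 1 ->
  forall ueps u : 'rV[R]_n -> R, BUC ueps ->
  viscosity_solution (fun x r p => lam * r + H x (eps^-1 *: x) p) ueps ->
  BUC u -> viscosity_solution (fun x r p => lam * r + Hbar x p) u ->
  forall x, lam * (ueps x - u x) <= C * Num.sqrt eps.
Proof.
pose nR : R := n%:R; pose slope := 2 * nR ^+ 2 * R0 + 1; pose radius := 5 * nR + 1.
have n0 : 0 <= nR by rewrite ler0n.
pose C := 1 + LH * (2 * R0 + radius + 2 * nR) + R0 * radius + Lam * (4 * slope * radius)
  + 2 * nR * R0.
have slope0 : 0 < slope by rewrite ltr_wpDl ?mulr_ge0 ?sqr_ge0.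
have radius0 : 0 < radius by rewrite ltr_wpDl ?mulr_ge0.
exists C.
  rewrite /C !addr_ge0// ?mulr_ge0 ?addr_ge0 ?mulr_ge0// ?(ltW slope0) ?(ltW radius0)//.
move=> lam eps /andP[lam0 lam1] epsI ueps u ubuc us [[Mu uM] _] [cu _ su] x0.
have [S [N [S0 S1 S2 <- [N0 NS epsN]]]] := sqrt_scale epsI.
have [k1 [w [k10 [M wM] uw hw]]] :=
  ueps_regular H1 R0_ge0 HM0 HR0 lam0 epsI S0 ubuc us.
have /andP[eps0 eps1] := epsI.
have wlip : forall y z, `|w z - w y| <= R0 * enorm (z - y).
  apply: (semiconvex_lipschitz (k := k1)) => y.
  by have [q [_ qR sc]] := hw y; exists q.
pose w1 y := w (eps *: y).
have w1lip y z : `|w1 z - w1 y| <= R0 * eps * enorm (z - y).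
  by apply: (le_trans (wlip _ _)); rewrite -scalerBr enormZ gtr0_norm// mulrA.
have w1M y : `|w1 y| <= M by exact: wM.
pose ubar y := boxavg N w1 (eps^-1 *: y).
have ubarM y : `|ubar y| <= M by exact: boxavg_bound.
have ubarlip y z : `|ubar z - ubar y| <= R0 * enorm (z - y).
  apply: (le_trans (boxavg_lip N0 w1lip _ _)).
  rewrite -scalerBr enormZ gtr0_norm ?invr_gt0// mulrA mulfK//.
  by rewrite gt_eqF.
have cubar : continuous ubar by exact: lipschitz_continuous ubarlip.
have ubar_ge y : w y - 2 * nR * R0 * S <= ubar y.
  have -> : w y = \sum_(k : {ffun 'I_n -> 'I_N}) prodw (@unifw R n N) k * w y.
    by rewrite -mulr_suml sum_prodw1 ?mul1r//; exact: unifw_sum.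
  rewrite lerBlDr -lerBlDl /ubar /boxavg -sumrB.
  under eq_bigr do rewrite -mulrBr.
  apply: (le_trans (ler_norm _)); apply: average_bound => [k||k].
  - exact: prodw_ge0 (unifw_ge0 (N := N)).
  - exact: sum_prodw1 (unifw_sum N0).
  rewrite /w1 scalerDr scalerA divff ?gt_eqF// scale1r.
  have := wlip (y + eps *: boxpt k) y; rewrite opprD addrA subrr sub0r enormN enormZ.
  rewrite (gtr0_norm eps0) => /le_trans; apply.
  have := boxpt_le (R := R) k; rewrite -/nR => h.
  have := ler_wpM2l (ltW eps0) h; have := ler_wpM2l n0 epsN => h1 h2.
  have : R0 * (eps * enorm (boxpt k)) <= R0 * (2 * nR * S).
    by rewrite ler_wpM2l//; lra.
  lra.
have k20 : 0 < 1 / (2 * S) by rewrite divr_gt0 ?mulr_gt0.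
(* This second sup-convolution is quantitative: it gives the contact from above of curvature 1 / S
   that [boxavg_near_linear] requires. *)
have [W sW] := supconv_exists cubar ubarM k20.
have WM := supconv_bounded k20 sW ubarM.
have Wjet y := supconv_lipschitz_jet y R0_ge0 S0 sW ubarlip.
have cW : continuous W.
  apply: (@lipschitz_continuous _ _ _ (2 * R0)).
  apply: (semiconvex_lipschitz (k := 1 / (2 * S))) => y.
  by have [z [q [? _ _ ? _]]] := Wjet y; exists q.
have Mu0 : 0 <= Mu by exact: le_trans (normr_ge0 _) (uM 0).
have M0' : 0 <= M by exact: le_trans (normr_ge0 _) (wM 0).
have [||k3 [x1 [k30 xiS _ uWx1 hmin]]] := @compare_at R n u W (Mu + M) x0 S cu cW _ _ S0.
- by move=> y; have := uM y; lra.
- by move=> y; have := WM y; lra.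
set xi := (2 * k3) *: (x1 - x0) in xiS.
have [z [q [qR zx1 tz sc [uW Wu]]]] := Wjet x1.
have [c /(super_touch su)] := min_lower_jet hmin (semiconvex_lower_jet (ltW k20) sc).
rewrite -/xi => superu.
have [v [pv [cv _ sv]]] := HbarP x1 (q - xi).
pose g y := eps^-1 * boxavg N w1 y.
have cg : continuous g.
  apply: continuous_scale; exact: lipschitz_continuous (boxavg_lip N0 w1lip).
pose a := slope * S.
have a0 : 0 < a by rewrite mulr_gt0.
pose y0 := eps^-1 *: z.
have eps'0 : 0 < eps^-1 by rewrite invr_gt0.
have tz' Y : boxavg N w1 Y <= boxavg N w1 y0 + eps * dot q (Y - y0) +
    1 / (2 * S) * (eps * enorm (Y - y0)) ^+ 2.
  have := tz (eps *: Y); rewrite /ubar scalerA mulVf ?gt_eqF// scale1r -/y0.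
  have -> : eps *: Y - z = eps *: (Y - y0).
    by rewrite scalerBr /y0 scalerA divff ?gt_eqF// scale1r.
  by rewrite dotZr enormZ (gtr0_norm eps0).
have near_linear y (m : 'rV[int]_n) : enorm (y - y0) <= n%:R ->
    g (y + map_mx intr m) <= g y + dot (q - xi) (map_mx intr m) +
    a * (enorm (map_mx intr m : 'rV[R]_n) + enorm (map_mx intr m : 'rV[R]_n) ^+ 2).
  exact: (boxavg_near_linear m N0 S0 S2 NS R0_ge0 w1lip tz' xiS).
have [y yr hy] := @cell_compare R n (fun y q => H x1 y q) (q - xi)
    (Hbar x1 (q - xi)) v g y0 a cv pv sv cg a0 near_linear.
have n0' := n0; have R0' := R0_ge0.
(* By periodicity all translates see the same fast variable [y], so the inequalities differ only in
   the slow variable and Jensen's inequality applies at fixed [y]. *)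
have /choice[qk hqk] : forall k : {ffun 'I_n -> 'I_N}, exists p,
    [/\ lam * w (eps *: (y + boxpt k)) + H (eps *: (y + boxpt k)) y p <= S,
    enorm p <= R0 & semiconvex_at w (eps *: (y + boxpt k)) p k1].
  move=> k; have [p [h1 h2 h3]] := hw (eps *: (y + boxpt k)); exists p; split=> //.
  by move: h1; rewrite scalerA mulVf ?gt_eqF// scale1r boxptE Hper.
pose th := prodw (@unifw R n N).
have th0 k : 0 <= th k by exact: prodw_ge0 (unifw_ge0 (N := N)).
have th1 : \sum_k th k = 1 by exact: sum_prodw1 (unifw_sum N0).
pose Qv := \sum_k th k *: qk k.
have scg : semiconvex_at g y Qv (k1 * eps).
  move=> y'; rewrite /g /boxavg dotC dot_sumr.
  have -> : k1 * eps * enorm (y' - y) ^+ 2 =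
      \sum_k th k * (k1 * eps * enorm (y' - y) ^+ 2) by rewrite -mulr_suml th1 mul1r.
  rewrite !mulr_sumr -big_split -sumrB /=; apply: ler_sum => k _.
  rewrite dotZr -/(th k) mulrCA -mulrDr -mulrBr [leRHS]mulrCA ler_wpM2l//.
  have [_ _ /(_ (eps *: (y' + boxpt k)))] := hqk k.
  rewrite -scalerBr opprD addrACA subrr addr0 dotZr enormZ (gtr0_norm eps0) /w1.
  move=> /(ler_wpM2l (ltW eps'0)); rewrite dotC.
  congr (_ <= _); field; by rewrite gt_eqF.
have [e eE He] := hy _ _ scg.
have QvR : enorm Qv <= R0.
  apply: (le_trans (enorm_sum _)); rewrite -[leRHS]mul1r -th1 mulr_suml.
  apply: ler_sum => k _; rewrite enormZ ger0_norm// ler_wpM2l//.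
  by have [] := hqk k.
have eS : enorm e <= 4 * slope * radius * S.
  by apply: (le_trans eE); rewrite /a /radius; clear; lra.
have eE' : enorm e <= E.
  apply: (le_trans eS); apply: le_trans HE; rewrite ler_piMr ?ltW//.
  by rewrite !mulr_gt0.
have E0 : 0 <= E by exact: le_trans (enorm_ge0 e) eE'.
have s1 : H x1 y (Qv - e) <= H x1 y Qv + Lam * (4 * slope * radius * S).
  have : H x1 y (Qv - e) - H x1 y Qv <= Lam * enorm (Qv - e - Qv).
    apply: HLam; last by apply: (le_trans QvR); rewrite lerDl.
    by apply: (le_trans (enormD _ _)); rewrite enormN lerD.
  rewrite addrAC subrr sub0r enormN.
  by have := ler_wpM2l Lam0 eS; clear; lra.
have s2 : H x1 y Qv <= \sum_k th k * H x1 y (qk k) by exact: convex_jensen.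
(* The three terms: from [x1] to the touching point [z], from [z] to the contact point of the cell
   problem, and across the averaging box. *)
have x1y (k : {ffun 'I_n -> 'I_N}) : enorm (x1 - eps *: (y + boxpt k)) <=
    (2 * R0 + radius + 2 * nR) * S.
  have -> : x1 - eps *: (y + boxpt k) =
      (x1 - z) + eps *: (y0 - y) - eps *: boxpt k.
    rewrite /y0 !scalerBr scalerA divff ?gt_eqF// scale1r scalerDr.
    by apply/rowP => i; rewrite !mxE; ring.
  apply: (le_trans (enormD _ _)); rewrite enormN enormZ (gtr0_norm eps0).
  have t1 := enormD (x1 - z) (eps *: (y0 - y)).
  rewrite enormZ (gtr0_norm eps0) (enormB x1 z) (enormB y0 y) in t1.
  have t2 : eps * enorm (y - y0) <= S * radius.
    rewrite ler_pM ?enorm_ge0 ?(ltW eps0)// -S2 expr2 ler_piMr// ltW//.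
  have t3 : eps * enorm (boxpt (R := R) k) <= nR * (2 * S).
    have := ler_wpM2l (ltW eps0) (boxpt_le (R := R) k).
    have := ler_wpM2l n0 epsN; rewrite -/nR; clear; lra.
  by move: t1 t2 t3 zx1; clear; lra.
have s3 : \sum_k th k * H x1 y (qk k) <= - (lam * boxavg N w1 y) +
    (S + LH * ((2 * R0 + radius + 2 * nR) * S)).
  set B := S + _; have -> : B = \sum_k th k * B by rewrite -mulr_suml th1 mul1r.
  rewrite /boxavg mulr_sumr -sumrN -big_split; apply: ler_sum => k _ /=.
  rewrite -/(th k) mulrCA -mulrN -mulrDr ler_wpM2l//.
  have [h1 _ _] := hqk k; have := HLH x1 (eps *: (y + boxpt k)) y (qk k).
  by have := ler_wpM2l LH0 (x1y k); move: h1; rewrite /w1 /B; clear; lra.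
have s4 : lam * W x1 - R0 * radius * S <= lam * boxavg N w1 y.
  have := ubarlip (eps *: y) z; rewrite ler_norml => /andP[_].
  rewrite {2}/ubar scalerA mulVf ?gt_eqF// scale1r.
  have -> : z - eps *: y = eps *: (y0 - y).
    by rewrite /y0 scalerBr scalerA divff ?gt_eqF// scale1r.
  rewrite enormZ (gtr0_norm eps0) (enormB y0) => h.
  have t2 : eps * enorm (y - y0) <= S * radius.
    by rewrite ler_pM ?enorm_ge0 ?(ltW eps0)// -S2 expr2 ler_piMr// ltW.
  have h1 : W x1 - boxavg N w1 y <= R0 * radius * S.
    by have := ler_wpM2l R0_ge0 t2; move: h Wu; clear; lra.
  have := ler_wpM2l (ltW lam0) h1.
  have : lam * (R0 * radius * S) <= R0 * radius * S.
    by rewrite ler_piMl ?(ltW lam1)// !mulr_ge0 ?R0_ge0 ?(ltW radius0) ?(ltW S0).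
  by clear; lra.
have s5 : lam * (W x0 - u x0) <= lam * (W x1 - u x1).
  by rewrite ler_wpM2l ?(ltW lam0)//; move: uWx1; clear; lra.
have s6 : lam * (ueps x0 - 2 * nR * R0 * S) <= lam * W x0.
  rewrite ler_wpM2l ?(ltW lam0)//; have [_ [_ [_ _ _ _ [h1 _]]]] := Wjet x0.
  by have := ubar_ge x0; have := uw x0; move: h1; clear; lra.
have s7 : lam * (2 * nR * R0 * S) <= 2 * nR * R0 * S.
  by rewrite ler_piMl ?(ltW lam1)// !mulr_ge0 ?(ltW S0).
by rewrite /C; move: superu s1 s2 s3 s4 s5 s6 s7 He; clear; lra.
Qed.

(** * Lower bound *)

Section KernelSums.
Context {R : realType} {n : nat}.
Implicit Types (x y z p q : 'rV[R]_n) (M L C B : R).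
Variables (h s z0 : R) (Q : nat).
Hypotheses (h0 : 0 < h) (s0 : 0 < s) (sh : s <= h).
Local Notation idx := {ffun 'I_n -> 'I_Q}.
Local Notation W k x := (wgtn h s z0 (Q := Q) (n := n) k x).
Variable psi : idx -> 'rV[R]_n -> R.

Definition glued x := \sum_k W k x * psi k x.

Lemma glued_bound B : (forall k x, `|psi k x| <= B) -> forall x, 0 <= B -> `|glued x| <= B.
Proof.
move=> pB x B0; apply: (le_trans (ler_norm_sum _ _ _)).
apply: (@le_trans _ _ (\sum_k W k x * B)).
  apply: ler_sum => k _; have W0 := wgtn_ge0 z0 h0 s0 k x.
  by rewrite normrM (ger0_norm W0) ler_wpM2l.
rewrite -mulr_suml ler_piMl//; exact: sum_wgtn_le1.
Qed.

Lemma glued_continuous L : 0 <= L ->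
  (forall k x y, `|psi k y - psi k x| <= L * enorm (y - x)) -> continuous glued.
Proof.
move=> L0 pL; apply: local_lip_continuous => x; apply: local_lip_sum => k.
apply: local_lipM; last by exists L.
exact: jet_lip (jet_wgtn s z0 h0 k x).
Qed.

Lemma glued_lower_jet x (q : idx -> 'rV[R]_n) :
  (forall k, lower_jet (psi k) x (q k)) ->
  lower_jet glued x (\sum_k (W k x *: q k + psi k x *: dwgtn h s z0 k x)).
Proof.
move=> pq; apply: lower_jet_sum => k.
apply: lower_jetM => //; first by move=> y; exact: wgtn_range.
exact: jet_wgtn.
Qed.

(** Each weight lives within [2 * h + s], at most [3 * h], of its node in every coordinate, so
    termwise comparison is needed only nearby. *)
Lemma weighted_le x (f g : idx -> R) :
  (forall k, enorm (x - gridpt s z0 k) <= 3 * n%:R * h -> f k <= g k) ->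
  \sum_k W k x * f k <= \sum_k W k x * g k.
Proof.
move=> fg; apply: ler_sum => k _; have [->|Wk] := eqVneq (W k x) 0.
  by rewrite !mul0r.
have W0 := wgtn_ge0 z0 h0 s0 k x.
rewrite ler_wpM2l//; apply: fg; apply: (le_trans (wgtn_support h0 s0 Wk)).
have -> : 3 * n%:R * h = n%:R * (3 * h) by ring.
rewrite ler_wpM2l//; have := sh; lra.
Qed.

End KernelSums.

Section EffectiveRegularisation.
Context {R : realType} {n : nat}.
Variables (M0 R0 : R) (Hbar : 'rV[R]_n -> 'rV[R]_n -> R).
Hypotheses (HbarM : forall x p, enorm p < 1 -> Hbar x p <= M0)
  (HbarR : forall x p, Hbar x p <= M0 -> enorm p <= R0).
Implicit Types (x y z p q : 'rV[R]_n).

(** The inequality keeps [Hbar] at the touching point [z], as no modulus of continuity of [Hbar] in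
    x is at hand; the displacement is recorded and paid for later through the Lipschitz bound of [H]
    in x. *)
Lemma u_regular (lam k : R) u : 0 < lam -> 0 < k -> BUC u ->
  viscosity_solution (fun x r p => lam * r + Hbar x p) u ->
  exists w, [/\ exists M, forall x, `|w x| <= M, forall y, u y <= w y &
    forall y, exists z q, [/\ lam * w y + Hbar z q <= 0, Hbar z q <= M0,
      enorm q <= R0, enorm (z - y) <= R0 / (2 * k) & semiconvex_at w y q k]].
Proof.
move=> lam0 k0 [[M uM] _] [cu subu supu].
have lb : forall x, - M0 <= lam * u x.
  exact: (super_lower_bound (G := Hbar) lam0 cu uM supu).
have HM z q : lam * u z + Hbar z q <= 0 -> Hbar z q <= M0 by have := lb z; lra.
have [z q c tz|z q hz|w [_ wM hw]] := @supconv_approx R n u M k R0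
    (fun z q => lam * u z + Hbar z q <= 0) cu uM k0.
- exact: (sub_touch subu tz).
- by apply: (HbarR (x := z)); exact: HM.
exists w; split; first by exists M.
  by move=> y; have [z [q []]] := hw y.
move=> y; have [z [q [hz zy sc _ wu]]] := hw y; exists z, q; split=> //.
- by have := ler_wpM2l (ltW lam0) wu; lra.
- exact: HM.
by apply: (HbarR (x := z)); exact: HM.
Qed.

End EffectiveRegularisation.

(** Here [E] covers two gradient errors: n (1 + 2 B) S from differentiating the weights, where B = 2
    R0 n bounds the correctors, and S from the penalty. *)
Lemma lower_bound (R : realType) (n : nat)
    (H : 'rV[R]_n -> 'rV[R]_n -> 'rV[R]_n -> R) (M0 R0 E Lam LH : R)
    (Hbar : 'rV[R]_n -> 'rV[R]_n -> R)
    (H1 : hypH1 H) (R0_ge0 : 0 <= R0)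
    (HR0 : forall x y p, H x y p <= M0 -> enorm p <= R0)
    (H3 : hypH3 H) (LH0 : 0 <= LH)
    (HLH : forall x1 x2 y p, H x1 y p <= H x2 y p + LH * enorm (x1 - x2))
    (Lam0 : 0 <= Lam)
    (HLam : forall x y p q, enorm p <= R0 + E -> enorm q <= R0 + E ->
       H x y p - H x y q <= Lam * enorm (p - q))
    (HbarP : forall x p, cell_problem_solvable H x p (Hbar x p))
    (HbarM : forall x p, enorm p < 1 -> Hbar x p <= M0)
    (HbarR : forall x p, Hbar x p <= M0 -> enorm p <= R0)
    (HE : n%:R * (1 + 2 * (2 * R0 * n%:R)) + 1 <= E) :
  exists2 C, 0 <= C & forall (lam eps : R), 0 < lam < 1 -> 0 < eps < 1 ->
  forall ueps u : 'rV[R]_n -> R, BUC ueps ->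
  viscosity_solution (fun x r p => lam * r + H x (eps^-1 *: x) p) ueps ->
  BUC u -> viscosity_solution (fun x r p => lam * r + Hbar x p) u ->
  forall x, lam * (u x - ueps x) <= C * Num.sqrt eps.
Proof.
pose nR : R := n%:R; pose B := 2 * R0 * nR.
have n0 : 0 <= nR by rewrite ler0n.
have B0 : 0 <= B by rewrite !mulr_ge0.
pose C := 1 + LH * (3 * nR + 1) + Lam * (nR * (1 + 2 * B) + 1) + 2 * B + 3 * nR * R0.
exists C.
  rewrite /C; do 5?[apply: addr_ge0]; rewrite ?mulr_ge0// ?addr_ge0 ?mulr_ge0//.
  by rewrite ?addr_ge0 ?mulr_ge0.
move=> lam eps /andP[lam0 lam1] /andP[eps0 eps1] ueps u [[Me ueM] _] [cue _ sue] ubuc us x0.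
set S := Num.sqrt eps.
have S0 : 0 < S by rewrite sqrtr_gt0.
have S2 : S ^+ 2 = eps by rewrite sqr_sqrtr// ltW.
have S1 : S < 1 by rewrite -(@ltr_pXn2r _ 2) ?nnegrE ?(ltW S0)// S2 expr1n.
have epsS : eps <= S by rewrite -S2 expr2 ler_piMl// ltW.
have R1 : 0 < R0 + 1 by rewrite ltr_wpDl.
have k10 : 0 < (R0 + 1) / S by rewrite divr_gt0.
have [k1 k1p k1E] : exists2 k1, 0 < k1 & k1 = (R0 + 1) / S by exists ((R0 + 1) / S).
have [w [[M wM] uw hw]] := u_regular HbarM HbarR lam0 k1p ubuc us.
have /choice[zf /choice[pf hzp]] := hw.
have zfS y : enorm (zf y - y) <= S.
  have [_ _ _ + _] := hzp y => /le_trans; apply.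
  have -> : R0 / (2 * k1) = S * (R0 / (2 * (R0 + 1))).
    by rewrite k1E; field; rewrite !gt_eqF.
  by rewrite ler_piMr ?(ltW S0)// ler_pdivrMr ?mulr_gt0//; lra.
have wlip : forall x y, `|w y - w x| <= R0 * enorm (y - x).
  apply: (semiconvex_lipschitz (k := k1)) => y.
  by have [_ _ pR _ sc] := hzp y; exists (pf y).
have [k2 k2p hphi] := corrector_approx H1 R0_ge0 HR0 S0.
have /choice[phi hphi'] : forall y, exists f : 'rV[R]_n -> R,
    (forall Y, `|f Y| <= B) /\ forall Y, exists q,
    [/\ H (zf y) Y (pf y + q) <= Hbar (zf y) (pf y) + S, enorm (pf y + q) <= R0,
      enorm q <= 2 * R0 & semiconvex_at f Y q k2].
  by move=> y; have [_ hM pR _ _] := hzp y; exact: hphi.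
have philip y : forall Y Z, `|phi y Z - phi y Y| <= 2 * R0 * enorm (Z - Y).
  apply: (semiconvex_lipschitz (k := k2)) => Y.
  by have [_ /(_ Y)[q [_ _ qR sc]]] := hphi' y; exists q.
have M_ge0 : 0 <= M by exact: le_trans (normr_ge0 _) (wM 0).
have Me_ge0 : 0 <= Me by exact: le_trans (normr_ge0 _) (ueM 0).
pose MT := Me + M + B.
have MT0 : 0 <= MT by rewrite !addr_ge0.
(* [s * D] is the error in [dwgtn_average] for weights of width [S] and semiconvexity constant [k1].
   The mesh [s] affects no other estimate as long as it stays below [S], so it absorbs [D]. *)
pose D := 6 * R0 / S + 3 * k1.
have D0 : 0 <= D by rewrite addr_ge0// ?divr_ge0 ?mulr_ge0// ltW.
have D1 : 0 < D + 1 by rewrite ltr_wpDl.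
have [s s0 sE] : exists2 s, 0 < s & s = S / (D + 1).
  by exists (S / (D + 1)); rewrite ?divr_gt0.
have sS : s <= S by rewrite sE ler_pdivrMr// ler_peMr ?lerDr// ltW.
have sD : s * D <= S.
  rewrite sE mulrAC ler_pdivrMr// ler_wpM2l ?(ltW S0)//; lra.
(* A finite grid suffices: [compare_at] confines the minimiser to this ball. The first node lies
   [2 * S] further out because the weights sum to 1 only from there on; elsewhere [T] need only be
   bounded and continuous. *)
pose rho := enorm x0 + (16 * MT + 1) / S.
pose z0 := - rho - 2 * S.
pose Q := (Num.truncn ((2 * rho + 2 * S) / s)).+1.
have hQ : 2 * rho + 2 * S <= s * Q%:R.
  by rewrite (mulrC s) -ler_pdivrMr// /Q ltW// truncnS_gt.
have covered x : enorm x <= rho ->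
    forall i, node s z0 0 + 2 * S <= x 0 i <= node s z0 Q.
  move=> xr i; have := le_trans (enorm_coord x i) xr; rewrite ler_norml => /andP[h1 h2].
  by rewrite /node mulr0 addr0 /z0; apply/andP; split;
    move: h1 h2 hQ; clear; lra.
pose gp (k : {ffun 'I_n -> 'I_Q}) : 'rV[R]_n := gridpt s z0 k.
(* The slow part is frozen at the node: its gradient is recovered solely from the derivatives of the
   weights. *)
pose psi k x := w (gp k) + eps * phi (gp k) (eps^-1 *: x).
have eB (f : R) : `|f| <= B -> `|eps * f| <= B * S.
  by move=> fB; rewrite normrM (gtr0_norm eps0) mulrC ler_pM// ltW.
have psiB k x : `|psi k x| <= MT.
  apply: (le_trans (ler_normD _ _)); have [h1 _] := hphi' (gp k).
  have := eB _ (h1 (eps^-1 *: x)); have := wM (gp k).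
  have : B * S <= B by rewrite ler_piMr// ltW.
  by move: Me_ge0; rewrite /MT; clear; lra.
have psilip k x y : `|psi k y - psi k x| <= 2 * R0 * enorm (y - x).
  rewrite /psi opprD addrACA subrr add0r -mulrBr normrM (gtr0_norm eps0).
  have := philip (gp k) (eps^-1 *: x) (eps^-1 *: y).
  rewrite -scalerBr enormZ (gtr0_norm (_ : 0 < eps^-1)) ?invr_gt0// => /(ler_wpM2l (ltW eps0)).
  by congr (_ <= _); field; rewrite gt_eqF.
have psijet k x : exists q, [/\ H (zf (gp k)) (eps^-1 *: x) (pf (gp k) + q) <=
      Hbar (zf (gp k)) (pf (gp k)) + S, enorm (pf (gp k) + q) <= R0 &
      lower_jet (psi k) x q].
  have [_ /(_ (eps^-1 *: x))[q [hq pqR _ sc]]] := hphi' (gp k); exists q; split=> //.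
  apply: (@semiconvex_lower_jet _ _ _ _ _ (k2 / eps)); first by rewrite divr_ge0 ?ltW.
  move=> y; have := sc (eps^-1 *: y).
  rewrite /psi -scalerBr dotZr enormZ gtr0_norm ?invr_gt0//.
  move=> /(ler_wpM2l (ltW eps0)) hy; rewrite -addrA -addrA lerD2l.
  by move: hy; congr (_ <= _); field; rewrite gt_eqF.
pose T := glued S s z0 psi.
have TM x : `|T x| <= MT by exact: glued_bound.
have cT : continuous T by apply: (glued_continuous S0) psilip; rewrite mulr_ge0.
have ueMT x : `|ueps x| <= MT 
  by rewrite (le_trans (ueM x))//; move: M_ge0 B0; rewrite /MT; clear; lra.
have [mu [x1 [mu0 xiS x1r uTx1 hmin]]] := compare_at x0 cue cT ueMT TM S0.
set xi := (2 * mu) *: (x1 - x0) in xiS.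
have MTS : 0 <= (16 * MT + 1) / S by rewrite divr_ge0 ?addr_ge0 ?mulr_ge0// ltW.
have cov0 : forall i, node s z0 0 + 2 * S <= x0 0 i <= node s z0 Q.
  by apply: covered; rewrite /rho lerDl.
have cov1 : forall i, node s z0 0 + 2 * S <= x1 0 i <= node s z0 Q.
  apply: covered; have -> : x1 = x0 + (x1 - x0) by rewrite addrC subrK.
  by apply: (le_trans (enormD _ _)); rewrite lerD2l.
have /choice[qk hqk] := psijet^~ x1.
pose W k x := wgtn S s z0 (Q := Q) (n := n) k x.
pose DW k x := dwgtn S s z0 (Q := Q) (n := n) k x.
have W0 k x : 0 <= W k x by exact: wgtn_ge0.
have W1 : \sum_k W k x1 = 1 by exact: sum_wgtn1.
pose pq k := pf (gp k) + qk k.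
pose Pv := \sum_k W k x1 *: pq k.
pose Qv := \sum_k (W k x1 *: qk k + psi k x1 *: DW k x1).
have jT : lower_jet T x1 Qv.
  by apply: glued_lower_jet => // k'; have [_ _] := hqk k'.
have [c /(super_touch sue)] := min_lower_jet hmin jT; rewrite -/xi => superue.
(* The derivatives of the weights act on two parts. On the values of [w] they reproduce the average
   of the subgradients [pf] up to [S]; on the correctors they give at most (2 / S) eps B = 2 B S. *)
have QPv : enorm (Qv - Pv) <= nR * ((1 + 2 * B) * S).
  apply: enorm_le_coord => i.
  have -> : (Qv - Pv) 0 i =
      (\sum_k DW k x1 0 i * w (gp k) - \sum_k W k x1 * pf (gp k) 0 i) +
      \sum_k DW k x1 0 i * (eps * phi (gp k) (eps^-1 *: x1)).
    rewrite /Qv /Pv -sumrB summxE -sumrB -big_split; apply: eq_bigr => k' _ /=.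
    by rewrite !mxE /psi; ring.
  have d2 : `|\sum_k DW k x1 0 i * w (gp k) - \sum_k W k x1 * pf (gp k) 0 i| <= S.
    apply: le_trans sD.
    apply: (dwgtn_average S0 s0 cov1 i (ltW k1p) sS) => y; first by have [] := hzp y.
    by have [] := hzp y.
  have d3 : `|\sum_k DW k x1 0 i * (eps * phi (gp k) (eps^-1 *: x1))| <= 2 * B * S.
    have := @sum_dwgtn_bound R n S s z0 Q S0 s0 x1 cov1
      (fun k' => eps * phi (gp k') (eps^-1 *: x1)) (eps * B) i.
    have -> : 2 / S * (eps * B) = 2 * B * S by rewrite -S2; field; rewrite gt_eqF.
    apply => k'; rewrite normrM (gtr0_norm eps0) ler_wpM2l ?(ltW eps0)//.
    by have [] := hphi' (gp k').
  by apply: (le_trans (ler_normD _ _)); move: d2 d3; clear; lra.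
have PvR : enorm Pv <= R0.
  apply: (le_trans (enorm_sum _)); rewrite -[leRHS]mul1r -W1 mulr_suml.
  apply: ler_sum => k' _; rewrite enormZ ger0_norm// ler_wpM2l//.
  by have [] := hqk k'.
pose e := Qv - xi - Pv.
have eS : enorm e <= (nR * (1 + 2 * B) + 1) * S.
  have -> : e = (Qv - Pv) + - xi by rewrite /e addrAC.
  by apply: (le_trans (enormD _ _)); rewrite enormN; move: QPv xiS; clear; lra.
have eE : enorm e <= E.
  apply: (le_trans eS); apply: le_trans HE; rewrite ler_piMr ?ltW//.
  by rewrite ltr_wpDl// !mulr_ge0// addr_ge0 ?mulr_ge0.
have E0 : 0 <= E by exact: le_trans (enorm_ge0 e) eE.
have s1 : H x1 (eps^-1 *: x1) (Qv - xi) <= H x1 (eps^-1 *: x1) Pv +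
    Lam * ((nR * (1 + 2 * B) + 1) * S).
  have : H x1 (eps^-1 *: x1) (Qv - xi) - H x1 (eps^-1 *: x1) Pv <=
      Lam * enorm (Qv - xi - Pv).
    apply: HLam; last by apply: (le_trans PvR); rewrite lerDl.
    have -> : Qv - xi = Pv + e by rewrite /e [RHS]addrC subrK.
    by apply: (le_trans (enormD _ _)); rewrite lerD.
  by have := ler_wpM2l Lam0 eS; rewrite -/e; clear; lra.
have s2 : H x1 (eps^-1 *: x1) Pv <= \sum_k W k x1 * H x1 (eps^-1 *: x1) (pq k).
  exact: convex_jensen.
have s3 : \sum_k W k x1 * H x1 (eps^-1 *: x1) (pq k) <=
   \sum_k W k x1 * (- (lam * w (gp k)) + (S + LH * ((3 * nR + 1) * S))).
  apply: (weighted_le S0 s0 sS) => k' near.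
  have [hq _ _] := hqk k'; have [hw1 _ _ _ _] := hzp (gp k').
  have := HLH x1 (zf (gp k')) (eps^-1 *: x1) (pq k').
  have x1z : enorm (x1 - zf (gp k')) <= (3 * nR + 1) * S.
    have -> : x1 - zf (gp k') = (x1 - gp k') + (gp k' - zf (gp k')).
      by rewrite addrA subrK.
    apply: (le_trans (enormD _ _)); have := zfS (gp k'); rewrite enormB.
    by move: near; rewrite -/nR -/(gp k'); clear; lra.
  by have := ler_wpM2l LH0 x1z; move: hq hw1; rewrite /pq; clear; lra.
have s4 : lam * T x1 - B * S <= lam * \sum_k W k x1 * w (gp k).
  have : T x1 - \sum_k W k x1 * w (gp k) <= B * S.
    rewrite /T /glued -sumrB; under eq_bigr do rewrite -mulrBr.
    apply: (le_trans (ler_norm _)); rewrite -[leRHS]mul1r -W1 mulr_suml.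
    apply: (le_trans (ler_norm_sum _ _ _)); apply: ler_sum => k' _.
    rewrite normrM ger0_norm// ler_wpM2l// /psi addrC addKr.
    by apply: eB; have [] := hphi' (gp k').
  have : lam * (B * S) <= B * S by rewrite ler_piMl ?(ltW lam1)// mulr_ge0// ltW.
  by move=> h1 h2; have := ler_wpM2l (ltW lam0) h2; move: h1; clear; lra.
have s5 : \sum_k W k x1 * (- (lam * w (gp k)) + (S + LH * ((3 * nR + 1) * S))) =
    - (lam * \sum_k W k x1 * w (gp k)) + (S + LH * ((3 * nR + 1) * S)).
  under eq_bigr do rewrite mulrDr.
  rewrite big_split /= -mulr_suml W1 mul1r; congr (_ + _).
  by rewrite mulr_sumr -sumrN; apply: eq_bigr => k' _; rewrite mulrN mulrCA.
have s6 : lam * (T x0 - ueps x0) <= lam * (T x1 - ueps x1).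
  by rewrite ler_wpM2l ?(ltW lam0)//; move: uTx1; clear; lra.
have s7 : u x0 - (3 * nR * R0 + B) * S <= T x0.
  have -> : u x0 - (3 * nR * R0 + B) * S =
      \sum_k W k x0 * (u x0 - (3 * nR * R0 + B) * S).
    by rewrite -mulr_suml sum_wgtn1// mul1r.
  apply: (weighted_le S0 s0 sS) => k' near; rewrite /psi.
  have [hB _] := hphi' (gp k'); have := eB _ (hB (eps^-1 *: x0)).
  have := wlip (gp k') x0; have := uw x0; have := ler_wpM2l R0_ge0 near.
  by rewrite -/nR -/(gp k') !ler_norml; clear; lra.
have s8 : lam * (u x0 - (3 * nR * R0 + B) * S) <= lam * T x0 by rewrite ler_wpM2l// ltW.
have s9 : lam * ((3 * nR * R0 + B) * S) <= (3 * nR * R0 + B) * S.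
  by rewrite ler_piMl ?(ltW lam1)// mulr_ge0 ?addr_ge0 ?mulr_ge0// ltW.
rewrite s5 in s3.
by rewrite /C; move: superue s1 s2 s3 s4 s6 s8 s9; clear; lra.
Qed.

(** * The rate of convergence *)

Lemma coercive_bound (R : realType) (n : nat)
    (H : 'rV[R]_n -> 'rV[R]_n -> 'rV[R]_n -> R) (M : R) : hypH2 H ->
  exists2 r, 0 <= r & forall x y p, H x y p <= M -> enorm p <= r.
Proof.
move=> /(_ (M + 1))[r hr]; exists `|r| => // x y p HM.
rewrite leNgt; apply/negP => /(le_lt_trans (ler_norm _)) /hr h.
have : ((M + 1)%:E <= (H x y p)%:E)%E.
  by apply: (le_trans h); apply: ereal_inf_lbound; exists (x, y).
by rewrite lee_fin; lra.
Qed.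

Lemma locally_lipschitz (R : realType) (n : nat)
    (H : 'rV[R]_n -> 'rV[R]_n -> 'rV[R]_n -> R) (r : R) : hypH1 H -> hypH3 H ->
  0 <= r -> exists2 L, 0 <= L & forall x y p q, enorm p <= r -> enorm q <= r ->
    H x y p - H x y q <= L * enorm (p - q).
Proof.
(* [convex_lipschitz] needs a bound on the closed ball of radius [r + 1], whereas [hypH1] speaks of
   open balls. *)
move=> H1 H3 r0; have [|[M hM] _] := H1 (r + 2); first by rewrite ltr_wpDl.
have M0 : 0 <= M.
  by apply: le_trans (normr_ge0 _) (hM 0 0 0 _); rewrite enorm0 ltr_wpDl.
exists (2 * M) => [|x y p q]; first by rewrite mulr_ge0.
apply: convex_lipschitz; first exact: H3.
by move=> q' hq; apply: hM; lra.
Qed.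

Theorem theorem1p2 (R : realType) (n : nat) (n_ge1 : (1 <= n)%N)
    (H : 'rV[R]_n -> 'rV[R]_n -> 'rV[R]_n -> R)
    (Hper : forall x p, Zperiodic (fun y => H x y p))
    (H1 : hypH1 H) (H2 : hypH2 H) (H3 : hypH3 H) (H4 : hypH4 H)
    (Hbar : 'rV[R]_n -> 'rV[R]_n -> R)
    (HbarP : effective_hamiltonian H Hbar) :
  exists2 C : R, 0 < C &
    forall (lam eps : R), 0 < lam < 1 -> 0 < eps < 1 ->
    forall (ueps u : 'rV[R]_n -> R),
      BUC ueps ->
      viscosity_solution
        (fun x r p => lam * r + H x (eps^-1 *: x) p) ueps ->
      BUC u ->
      viscosity_solution (fun x r p => lam * r + Hbar x p) u ->
      (supnorm (fun x => (ueps x - u x)%R) <= (C * Num.sqrt eps / lam)%:E)%E.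
Proof.
have [|[M0 hM0] _] := H1 1; first exact: ltr01.
have HM0 x y p : enorm p < 1 -> H x y p <= M0.
  by move=> /(hM0 x y); rewrite ler_norml => /andP[].
(* The margin 1 lets the gradient bound pass to [Hbar]: for |p| > R0 the cell problem only gives the
   weak inequality [M0 + 1 <= Hbar x p], which still contradicts [Hbar x p <= M0]. *)
have [R0 R00 HR1] := coercive_bound (M0 + 1) H2.
have HR0 x y p : H x y p <= M0 -> enorm p <= R0.
  by move=> h; apply: (HR1 x y); lra.
have [LH LH0 hLH] := H4.
have HLH x1 x2 y p : H x1 y p <= H x2 y p + LH * enorm (x1 - x2).
  by have := hLH x1 x2 y p; rewrite ler_norml; lra.
have cellP x p : cell_problem_solvable H x p (Hbar x p) by have [] := HbarP x p.
have HbarM x p : enorm p < 1 -> Hbar x p <= M0.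
  by move=> p1; apply: (effective_le (cellP x p)) => y; exact: HM0.
have HbarR x p : Hbar x p <= M0 -> enorm p <= R0.
  move=> hb; rewrite leNgt; apply/negP => pR.
  have : M0 + 1 <= Hbar x p.
    apply: (effective_ge (cellP x p)) => y; rewrite leNgt; apply/negP => /ltW /HR1.
    by rewrite leNgt pR.
  by lra.
pose E1 : R := 4 * (2 * n%:R ^+ 2 * R0 + 1) * (5 * n%:R + 1).
pose E2 : R := n%:R * (1 + 2 * (2 * R0 * n%:R)) + 1.
have E10 : 0 <= E1 by rewrite !mulr_ge0 ?addr_ge0 ?mulr_ge0 ?sqr_ge0.
have E20 : 0 <= E2 by rewrite addr_ge0 ?mulr_ge0 ?addr_ge0 ?mulr_ge0.
have [|Lam Lam0 HLam] := @locally_lipschitz R n H (R0 + (E1 + E2)) H1 H3.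
  exact: addr_ge0 R00 (addr_ge0 E10 E20).
have HE1 : E1 <= E1 + E2 by rewrite lerDl.
have HE2 : E2 <= E1 + E2 by rewrite lerDr.
have [Cu Cu0 hu] := upper_bound Hper H1 R00 HM0 HR0 H3 (ltW LH0) HLH Lam0 HLam cellP HE1.
have [Cl Cl0 hl] := lower_bound H1 R00 HR0 H3 (ltW LH0) HLH Lam0 HLam cellP HbarM HbarR HE2.
exists (Cu + Cl + 1); first by lra.
move=> lam eps lamI epsI ueps u bueps sueps bu su.
have {}hu := hu lam eps lamI epsI ueps u bueps sueps bu su.
have {}hl := hl lam eps lamI epsI ueps u bueps sueps bu su.
apply: ge_ereal_sup => _ [x _ <-]; rewrite lee_fin.
have /andP[lam0 _] := lamI; have S0 : 0 <= Num.sqrt eps by exact: sqrtr_ge0.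
rewrite ler_pdivlMr// mulrC -{1}(gtr0_norm lam0) -normrM ler_norml.
have := hu x; have := hl x; have := mulr_ge0 Cu0 S0; have := mulr_ge0 Cl0 S0; lra.
Qed.
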